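(* Let $a>0$ and $b\in\mathbb{C}$ with $\mathrm{Re}(b)\ge 0$, let $\phi$ be the self-map of $\mathbb{C}_+$ defined by $\phi(w)=aw+b$, and let $C_\phi$ be the composition operator $C_\phi f=f\circ\phi$ on $H^2(\mathbb{C}_+)$. Then $C_\phi$ is cohyponormal on $H^2(\mathbb{C}_+)$ if and only if $a\ge 1$ or $\mathrm{Re}(b)=0$.
   Context: $\mathbb{C}_+=\{z\in\mathbb{C}:\mathrm{Re}(z)>0\}$. $H^2(\mathbb{C}_+)$ is the Hilbert space of analytic functions $f$ on $\mathbb{C}_+$ with $\|f\|=\left(\sup_{0<x<\infty}\frac{1}{\pi}\int_{-\infty}^{\infty}|f(x+iy)|^2\,dy\right)^{1/2}<\infty$. For $a>0$ and $\mathrm{Re}(b)\ge 0$ the map $\phi(w)=aw+b$ induces a bounded composition operator on $H^2(\mathbb{C}_+)$. A bounded operator $T$ on a Hilbert space $\mathcal{H}$ is cohyponormal if $\|Tx\|\le\|T^*x\|$ for all $x\in\mathcal{H}$. *)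

(* Defs.v *)
From HB Require Import structures.
From mathcomp Require Import all_boot all_order all_algebra.
From mathcomp Require Import complex.
From mathcomp Require Import all_classical all_reals all_analysis.
Set Implicit Arguments.
Unset Strict Implicit.
Unset Printing Implicit Defensive.
Import Order.TTheory GRing.Theory Num.Theory.
Import numFieldNormedType.Exports.
Local Open Scope classical_set_scope.
Local Open Scope ring_scope.
Local Open Scope complex_scope.

Section Operators.
(* A complex Hilbert space is given by the set [H] of its elements inside an
   ambient vector space [V] and by its norm [N]. *)
Variables (R : realType) (V : lmodType R[i]) (H : set V) (N : V -> R).

(* The inner product that induces the norm, recovered by polarization; it is
   linear in the first argument. *)
Definition dot (f g : V) : R[i] :=
  4^-1 * \sum_(k < 4) ('i ^+ k * ((N (f + 'i ^+ k *: g)) ^+ 2)%:C).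

Definition bounded_operator (T : V -> V) : Prop :=
  [/\ forall f, H f -> H (T f),
      forall (c : R[i]) (f g : V), H f -> H g ->
        T (c *: f + g) = c *: T f + T g
    & exists M : R, forall f, H f -> N (T f) <= M * N f].

Definition is_adjoint (T S : V -> V) : Prop :=
  bounded_operator S /\
  forall f g, H f -> H g -> dot (T f) g = dot f (S g).

(* The adjoint of a bounded operator on a Hilbert space exists and is unique
   (as an operator on [H]), so the existential below only names it. *)
Definition cohyponormal (T : V -> V) : Prop :=
  bounded_operator T /\
  exists2 S : V -> V, is_adjoint T S & forall f, H f -> N (T f) <= N (S f).

End Operators.

Section Hardy.
Variable R : realType.

Definition right_half_plane : set R[i] := [set z | 0 < complex.Re z].

Definition hardy_sqnorm (f : R[i] -> R[i]^o) : \bar R :=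
  ereal_sup [set ((pi^-1)%:E *
    \int[lebesgue_measure]_(y in [set: R])
      ((complex.Re `|f (x +i* y)%C| ^+ 2)%R)%:E)%E | x in [set x : R | 0 < x]].

Definition hardy_norm (f : R[i] -> R[i]^o) : R :=
  Num.sqrt (fine (hardy_sqnorm f)).

(* A function on the right half-plane is represented by its extension by 0,
   so that two elements of [hardy2] are equal iff they agree on the half-plane. *)
Definition hardy2 : set (R[i] -> R[i]^o) :=
  [set f | [/\ forall z, right_half_plane z -> derivable (f : R[i]^o -> R[i]^o) z 1,
               forall z, ~ right_half_plane z -> f z = 0
             & (hardy_sqnorm f < +oo)%E]].

(* [phi] is meant to map the right half-plane to itself; [f \o phi] is extended
   by 0 as in [hardy2]. *)
Definition composition_operator (phi : R[i] -> R[i]) (f : R[i] -> R[i]^o) :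
    R[i] -> R[i]^o :=
  fun w => if 0 < complex.Re w then f (phi w) else 0.

End Hardy.
Arguments hardy2 R : clear implicits.

(* Main.v *)
Require Import Defs.
From mathcomp Require Import all_boot all_order all_algebra.
From mathcomp Require Import complex lra ring.
From mathcomp Require Import all_classical all_reals all_analysis.
From mathcomp Require Import measurable_realfun.
Set Implicit Arguments.
Unset Strict Implicit.
Unset Printing Implicit Defensive.
Import Order.TTheory GRing.Theory Num.Theory.
Import numFieldNormedType.Exports.
Local Open Scope classical_set_scope.
Local Open Scope ring_scope.
Local Open Scope complex_scope.

(* Let [m f x] be [1/pi] times the integral of [|f(x + iy)|^2] over [y].  For [f],
   [g] in the Hardy space, [h z = f z * conj (g (c - conj z))] is holomorphic on
   the strip [0 < Re z < c], and Cauchy's theorem shows that the integral of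
   [f(x1 + iy) * conj (g(x2 + iy))] over [y] depends on [x1 + x2] only.  With
   [f = g] this makes [m f] midpoint convex; being bounded, [m f] is nonincreasing,
   so the norm of [f] squared is the limit of [m f x] as [x -> 0+].  The
   same invariance identifies the adjoint of [C_phi] as
   [S g z = a^-1 * g ((z + conj b) / a)].  A change of variables gives
   [m (C_phi f) x = a^-1 * m f (a x + Re b)] and
   [m (S f) x = a^-1 * m f ((x + Re b) / a)], so that up to the factor [a^-1] the
   squared norms are the suprema of [m f] over [x > Re b] and [x > Re b / a].  The
   second one is the larger when [a >= 1] or [Re b = 0]; otherwise it is strictly
   smaller for [f z = 1 / (z + 1)], for which [m f x = 1 / (x + 1)]. *)

(** * Goursat's theorem for closed forms *)

Section SegmentIntegral.
Context {R : realType}.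
Notation mu := (@lebesgue_measure R).
Implicit Type f : R -> R.

Lemma segment_integrable f a b : {in `[a, b], continuous f} ->
  mu.-integrable `[a, b] (EFin \o f).
Proof.
move=> cf; apply: continuous_compact_integrable; first exact: segment_compact.
exact: continuous_subspace_itv.
Qed.

Lemma segment_integral_split f a c b : a <= c -> c <= b ->
  {in `[a, b], continuous f} ->
  \int[mu]_(x in `[a, b]) f x =
  \int[mu]_(x in `[a, c]) f x + \int[mu]_(x in `[c, b]) f x.
Proof.
move=> ac cb cf.
have fi := segment_integrable cf.
have := @Rintegral_itvB R f (BLeft a) (BRight b) c fi.
rewrite !bnd_simp => /(_ ac cb) /eqP.
rewrite subr_eq => /eqP ->; rewrite addrC; congr (_ + _).
apply: Rintegral_itv_obnd_cbnd.
apply: integrableS fi => //.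
apply: subset_itv; rewrite ?bnd_simp//.
Qed.

Lemma segment_integral_bound f a b M : a <= b ->
  {in `[a, b], continuous f} -> (forall x, a <= x <= b -> `|f x| <= M) ->
  `|\int[mu]_(x in `[a, b]) f x| <= M * (b - a).
Proof.
move=> ab cf fM.
have fi := segment_integrable cf.
apply: (le_trans (le_normr_Rintegral _ fi)) => //.
have -> : M * (b - a) = \int[mu]_(x in `[a, b]) M.
  rewrite Rintegral_cst//= lebesgue_measure_itv/= lte_fin.
  by case: ltgtP ab => //= -> _; rewrite subrr.
apply: le_Rintegral => //.
- exact: (integrable_norm fi).
- by apply: segment_integrable => x _; exact: cvg_cst.
Qed.

End SegmentIntegral.

Section ClosedForm.
Context {R : realType}.
Notation mu := (@lebesgue_measure R).
Implicit Types P Q : R -> R -> R.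

(** Total differentiability with gradient [(p, q)]. The error is measured in the l^1 norm, so that
    on a rectangle it is controlled by width plus height. *)
Definition diff_at2 P x y p q := forall e : R, 0 < e ->
  exists2 d : R, 0 < d & forall s t, `|s - x| < d -> `|t - y| < d ->
    `|P s t - P x y - (p * (s - x) + q * (t - y))|
      <= e * (`|s - x| + `|t - y|).

Lemma diff_at2_locally_small P x y p q : diff_at2 P x y p q -> forall e : R, 0 < e ->
  exists2 d : R, 0 < d & forall s t, `|s - x| < d -> `|t - y| < d ->
    `|P s t - P x y| < e.
Proof.
move=> dP e e0; have [d d0 dPd] := dP 1 ltr01.
(* Differentiability with error 1 gives a local Lipschitz constant [1 + |p| + |q|], which [K]
   exceeds. *)
pose K := `|p| + `|q| + 2.
have K0 : 0 < K by rewrite /K; have := normr_ge0 p; have := normr_ge0 q; lra.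
exists (Num.min d (e / (2 * K))).
  by rewrite lt_min d0 divr_gt0// mulr_gt0.
move=> s t; rewrite !lt_min => /andP[sd se] /andP[td te].
have := dPd s t sd td; rewrite mul1r => H.
set A := `|s - x| in H se; set B := `|t - y| in H te.
have A0 : 0 <= A by exact: normr_ge0.
have B0 : 0 <= B by exact: normr_ge0.
have H2 : `|p * (s - x) + q * (t - y)| <= `|p| * A + `|q| * B.
  by rewrite (le_trans (ler_normD _ _))// !normrM.
have H3 : `|P s t - P x y| <= (A + B) + (`|p| * A + `|q| * B).
  rewrite -(subrK (p * (s - x) + q * (t - y)) (P s t - P x y)).
  by rewrite (le_trans (ler_normD _ _))// lerD.
apply: (le_lt_trans H3).
have pA : `|p| * A <= `|p| * (A + B) by rewrite ler_wpM2l// lerDl.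
have qB : `|q| * B <= `|q| * (A + B) by rewrite ler_wpM2l// lerDr.
have KAB : K * (A + B) < e.
  have : A + B < e / K.
    have -> : e / K = e / (2 * K) + e / (2 * K) by field; rewrite gt_eqF.
    exact: ltrD.
  by rewrite ltr_pdivlMr// mulrC.
apply: le_lt_trans KAB; rewrite /K; nra.
Qed.

Lemma diff_at2_continuous1 P x y p q : diff_at2 P x y p q ->
  {for x, continuous (P ^~ y)}.
Proof.
move=> /diff_at2_locally_small H; apply/cvgrPdist_lt => e e0.
have [d d0 Hd] := H e e0.
near=> s.
rewrite distrC; apply: Hd; last by rewrite subrr normr0.
by rewrite distrC; near: s; exact: cvgr_dist_lt.
Unshelve. all: end_near. Qed.

Lemma diff_at2_continuous2 P x y p q : diff_at2 P x y p q ->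
  {for y, continuous (P x)}.
Proof.
move=> /diff_at2_locally_small H; apply/cvgrPdist_lt => e e0.
have [d d0 Hd] := H e e0.
near=> s.
rewrite distrC; apply: Hd; first by rewrite subrr normr0.
by rewrite distrC; near: s; exact: cvgr_dist_lt.
Unshelve. all: end_near. Qed.

(* The common value [d] is that of the partial derivatives [dP/dt] and [dQ/ds]. *)
Definition closed_at P Q x y :=
  exists d p q, diff_at2 P x y p d /\ diff_at2 Q x y d q.

(* The counterclockwise integral of [P ds + Q dt] along the boundary of the
   rectangle [[x, x + w] * [y, y + l]]. *)
Definition circulation P Q x y w l : R :=
  \int[mu]_(s in `[x, x + w]) (P s y - P s (y + l)) +
  \int[mu]_(t in `[y, y + l]) (Q (x + w) t - Q x t).

Section Rectangle.
Variables (P Q : R -> R -> R) (x1 x2 : R).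
Hypothesis closedPQ : forall s t, x1 <= s <= x2 -> closed_at P Q s t.

Let contP t : {in `[x1, x2], continuous (P ^~ t)}.
Proof.
move=> s; rewrite in_itv/= => /(@closedPQ s t)[d [p [q [H _]]]].
exact: diff_at2_continuous1 H.
Qed.

Let contQ s : x1 <= s <= x2 -> continuous (Q s).
Proof.
move=> sx t; have [d [p [q [_ H]]]] := closedPQ t sx.
exact: diff_at2_continuous2 H.
Qed.

Let itvP t t' a b : x1 <= a -> b <= x2 ->
  {in `[a, b], continuous (fun s => P s t - P s t')}.
Proof.
move=> xa bx s; rewrite in_itv/= => /andP[as_ sb].
have sx : s \in `[x1, x2] by rewrite in_itv/= (le_trans xa)//= (le_trans sb).
by apply: continuousB; exact: contP.
Qed.

Let itvQ s s' a b : x1 <= s <= x2 -> x1 <= s' <= x2 ->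
  {in `[a, b], continuous (fun t => Q s t - Q s' t)}.
Proof. by move=> sx sx' t _; apply: continuousB; exact: contQ. Qed.

(** A side shared by two quarters is traversed once in each direction and cancels. [E1] and [E2]
    insert the horizontal and the vertical midline. *)
Let circulation_halve x y w l : x1 <= x -> x + 2 * w <= x2 -> 0 <= w -> 0 <= l ->
  circulation P Q x y (2 * w) (2 * l) =
  circulation P Q x y w l + circulation P Q (x + w) y w l +
  circulation P Q x (y + l) w l + circulation P Q (x + w) (y + l) w l.
Proof.
move=> xx1 xwx2 w0 l0; rewrite /circulation.
have -> : x + 2 * w = x + w + w by ring.
have -> : y + 2 * l = y + l + l by ring.
have E1 : \int[mu]_(s in `[x, x + w + w]) (P s y - P s (y + l + l)) =
   \int[mu]_(s in `[x, x + w + w]) (P s y - P s (y + l)) +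
   \int[mu]_(s in `[x, x + w + w]) (P s (y + l) - P s (y + l + l)).
  rewrite -RintegralD//.
  - by congr Rintegral; apply/funext => s; ring.
  - by apply: segment_integrable; apply: itvP => //; lra.
  - by apply: segment_integrable; apply: itvP => //; lra.
have E2 : \int[mu]_(t in `[y, y + l + l]) (Q (x + w + w) t - Q x t) =
   \int[mu]_(t in `[y, y + l + l]) (Q (x + w) t - Q x t) +
   \int[mu]_(t in `[y, y + l + l]) (Q (x + w + w) t - Q (x + w) t).
  rewrite -RintegralD//.
  - by congr Rintegral; apply/funext => s; ring.
  - by apply: segment_integrable; apply: itvQ => //; lra.
  - by apply: segment_integrable; apply: itvQ => //; lra.
rewrite E1 E2.
rewrite !(@segment_integral_split R _ x (x + w) (x + w + w))//;
  try lra; try by apply: itvP; lra.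
rewrite !(@segment_integral_split R _ y (y + l) (y + l + l))//;
  try lra; try by apply: itvQ; lra.
Qed.

(** The affine parts of [P] and [Q] at [(x, y)] have zero circulation, since the two cross
    derivatives are the same number [m]. Only the differentiability errors remain: at most
    [e * (w + l)] per pair of opposite points, integrated over [w] and over [l]. *)
Let circulation_local x y : x1 <= x <= x2 -> forall e : R, 0 < e ->
  exists2 d : R, 0 < d & forall a b w l : R, x1 <= a -> a + w <= x2 ->
    a <= x <= a + w -> b <= y <= b + l -> w < d -> l < d ->
    `|circulation P Q a b w l| <= e * (w + l) ^+ 2.
Proof.
move=> xx e e0.
have [m [p [q [dP dQ]]]] := closedPQ y xx.
have e20 : 0 < e / 2 by rewrite divr_gt0.
have [d1 d10 H1] := dP _ e20.
have [d2 d20 H2] := dQ _ e20.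
exists (Num.min d1 d2); first by rewrite lt_min d10.
move=> a b w l xa awx /andP[ax xaw] /andP[b_y ybl].
rewrite !lt_min => /andP[w1 w2] /andP[l1 l2].
have dist (u v k c : R) : c <= u <= c + k -> c <= v <= c + k -> `|u - v| <= k.
  by move=> ? ?; rewrite ler_norml; lra.
have distx s : a <= s <= a + w -> `|s - x| <= w by move=> ?; apply: (@dist _ _ _ a) => //; lra.
have disty t : b <= t <= b + l -> `|t - y| <= l by move=> ?; apply: (@dist _ _ _ b) => //; lra.
(* The affine part of [P] contributes [- m * l * w] here and that of [Q] contributes [m * l * w] in
   [IQ]; the two cancel. A side of length zero is treated apart, as the measure formula for an
   interval distinguishes that case. *)
have IP : \int[mu]_(s in `[a, a + w]) (P s b - P s (b + l)) =
    \int[mu]_(s in `[a, a + w]) (P s b - P s (b + l) + m * l) - m * l * w.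
  rewrite [in RHS]RintegralD//; last 2 first.
  - by apply: segment_integrable; apply: itvP; lra.
  - by apply: segment_integrable => ? _; exact: cvg_cst.
  rewrite Rintegral_cst//= lebesgue_measure_itv/= lte_fin.
  case: ltgtP => [_|?|E]; first by rewrite /=; ring.
    lra.
  have -> : w = 0 by apply: (addrI a); rewrite addr0 -E.
  by rewrite fine0 !(mulr0, addr0, subr0).
have IQ : \int[mu]_(t in `[b, b + l]) (Q (a + w) t - Q a t) =
    \int[mu]_(t in `[b, b + l]) (Q (a + w) t - Q a t - m * w) + m * l * w.
  rewrite [in RHS]RintegralB//; last 2 first.
  - by apply: segment_integrable; apply: itvQ; lra.
  - by apply: segment_integrable => ? _; exact: cvg_cst.
  rewrite Rintegral_cst//= lebesgue_measure_itv/= lte_fin.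
  case: ltgtP => [_|?|E]; first by rewrite /=; ring.
    lra.
  have -> : l = 0 by apply: (addrI b); rewrite addr0 -E.
  by rewrite fine0 !(mulr0, mul0r, subr0, addr0).
have -> : circulation P Q a b w l =
  \int[mu]_(s in `[a, a + w]) (P s b - P s (b + l) + m * l) +
  \int[mu]_(t in `[b, b + l]) (Q (a + w) t - Q a t - m * w).
  by rewrite /circulation IP IQ; ring.
have BP : `|\int[mu]_(s in `[a, a + w]) (P s b - P s (b + l) + m * l)| <=
    e * (w + l) * w.
  rewrite -[leRHS](_ : e * (w + l) * (a + w - a) = _); last by ring.
  apply: segment_integral_bound; first lra.
    by move=> s sa; apply: cvgD; [exact: (@itvP _ _ a (a + w))|exact: cvg_cst].
  move=> s sa; have ds := distx s sa.
  have [? ?] : `|b - y| <= l /\ `|b + l - y| <= l by split; apply: disty; lra.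
  have := H1 s b; move/(_ (le_lt_trans ds w1)) => /(_ ltac:(lra)) h1.
  have := H1 s (b + l); move/(_ (le_lt_trans ds w1)) => /(_ ltac:(lra)) h2.
  have -> : P s b - P s (b + l) + m * l =
    (P s b - P x y - (p * (s - x) + m * (b - y))) -
    (P s (b + l) - P x y - (p * (s - x) + m * (b + l - y))) by ring.
  apply: (le_trans (ler_normB _ _)).
  have wl : w + l >= 0 by lra.
  have B1 : e / 2 * (`|s - x| + `|b - y|) <= e / 2 * (w + l).
    by apply: ler_wpM2l; [exact: ltW|exact: lerD].
  have B2 : e / 2 * (`|s - x| + `|b + l - y|) <= e / 2 * (w + l).
    by apply: ler_wpM2l; [exact: ltW|exact: lerD].
  lra.
have BQ : `|\int[mu]_(t in `[b, b + l]) (Q (a + w) t - Q a t - m * w)| <=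
    e * (w + l) * l.
  rewrite -[leRHS](_ : e * (w + l) * (b + l - b) = _); last by ring.
  apply: segment_integral_bound; first lra.
    move=> s sa; apply: cvgB; last exact: cvg_cst.
    by apply: (@itvQ _ _ b (b + l)) => //; lra.
  move=> t ta; have dt := disty t ta.
  have [? ?] : `|a - x| <= w /\ `|a + w - x| <= w by split; apply: distx; lra.
  have h1 : _ := H2 a t ltac:(lra) ltac:(lra).
  have h2 : _ := H2 (a + w) t ltac:(lra) ltac:(lra).
  have -> : Q (a + w) t - Q a t - m * w =
    (Q (a + w) t - Q x y - (m * (a + w - x) + q * (t - y))) -
    (Q a t - Q x y - (m * (a - x) + q * (t - y))) by ring.
  apply: (le_trans (ler_normB _ _)).
  have B1 : e / 2 * (`|a - x| + `|t - y|) <= e / 2 * (w + l).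
    by apply: ler_wpM2l; [exact: ltW|exact: lerD].
  have B2 : e / 2 * (`|a + w - x| + `|t - y|) <= e / 2 * (w + l).
    by apply: ler_wpM2l; [exact: ltW|exact: lerD].
  lra.
apply: (le_trans (ler_normD _ _)).
have -> : e * (w + l) ^+ 2 = e * (w + l) * w + e * (w + l) * l by ring.
exact: lerD.
Qed.

(* Goursat's bisection argument, which needs no continuity of the partial
   derivatives. *)
Lemma circulation_closed y w l : x1 + w = x2 -> 0 <= w -> 0 <= l ->
  circulation P Q x1 y w l = 0.
Proof.
move=> xw w0 l0; apply: contrapT => /eqP; rewrite -normr_gt0.
set c := `|_| => c0.
pose W n : R := w / 2 ^+ n; pose L n : R := l / 2 ^+ n.
have Wd n : W n = 2 * W n.+1.
  by rewrite /W exprS; field; rewrite expf_neq0.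
have Ld n : L n = 2 * L n.+1.
  by rewrite /L exprS; field; rewrite expf_neq0.
have W0 n : 0 <= W n by rewrite divr_ge0// exprn_ge0.
have L0 n : 0 <= L n by rewrite divr_ge0// exprn_ge0.
pose good n (z : R * R) := [/\ x1 <= z.1, z.1 + W n <= x2 &
  c / 4 ^+ n <= `|circulation P Q z.1 z.2 (W n) (L n)|].
pose next n (z z' : R * R) := [/\ z.1 <= z'.1, z'.1 + W n.+1 <= z.1 + W n,
   z.2 <= z'.2, z'.2 + L n.+1 <= z.2 + L n & good n.+1 z'].
(* If all four quarters fell short of a quarter of the lower bound, their sum would fall short of
   the whole. *)
have step n z : good n z -> exists z', next n z z'.
  case: z => [a b] [/= ga gb gc].
  have W1 := W0 n.+1; have L1 := L0 n.+1; have WE := Wd n; have LE := Ld n.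
  have := @circulation_halve a b (W n.+1) (L n.+1) ga ltac:(lra) W1 L1.
  rewrite -Wd -Ld => E.
  apply: contrapT => /forallNP H.
  have small a' b' : a <= a' -> a' + W n.+1 <= a + W n -> b <= b' ->
      b' + L n.+1 <= b + L n ->
      `|circulation P Q a' b' (W n.+1) (L n.+1)| < c / 4 ^+ n.+1.
    move=> h1 h2 h3 h4; rewrite ltNge; apply/negP => h5; apply: (H (a', b')).
    by split => //; split => //=; lra.
  have s1 := small a b ltac:(lra) ltac:(lra) ltac:(lra) ltac:(lra).
  have s2 := small (a + W n.+1) b ltac:(lra) ltac:(lra) ltac:(lra) ltac:(lra).
  have s3 := small a (b + L n.+1) ltac:(lra) ltac:(lra) ltac:(lra) ltac:(lra).
  have s4 := small (a + W n.+1) (b + L n.+1) ltac:(lra) ltac:(lra) ltac:(lra) ltac:(lra).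
  have C4 : c / 4 ^+ n = 4 * (c / 4 ^+ n.+1).
    by rewrite exprS; field; rewrite expf_neq0.
  move: gc; rewrite C4 leNgt => /negP; apply.
  rewrite E; apply: (le_lt_trans (ler_normD _ _)).
  apply: (@le_lt_trans _ _ (`|circulation P Q a b (W n.+1) (L n.+1)| +
    `|circulation P Q (a + W n.+1) b (W n.+1) (L n.+1)| +
    `|circulation P Q a (b + L n.+1) (W n.+1) (L n.+1)| +
    `|circulation P Q (a + W n.+1) (b + L n.+1) (W n.+1) (L n.+1)|)).
    by rewrite lerD2r (le_trans (ler_normD _ _))// lerD2r ler_normD.
  lra.
(* The default [(0, 0)] is never returned: by [step], a good rectangle always has a successor. *)
pose z := fix z n := if n is m.+1 then xget (0, 0) [set z' | next m (z m) z']
                     else (x1, y).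
have gz : forall n, good n (z n) /\ next n (z n) (z n.+1).
  have gn n : good n (z n) -> next n (z n) (z n.+1).
    by move=> /step[z' nz']; rewrite /=; case: xgetP => [? _ //|/(_ z')/(_ nz')].
  elim=> [|n [_ IH]]; last by split; [|apply: gn]; case: IH.
  have g0 : good 0%N (z 0%N).
    split => /=; rewrite /W ?expr0 ?divr1 ?xw//.
    by rewrite /L expr0 !divr1.
  by split => //; exact: gn.
have mon1 : forall n k, (z n).1 <= (z (n + k)%N).1 /\
    (z (n + k)%N).1 + W (n + k)%N <= (z n).1 + W n.
  move=> n; elim=> [|k [IH1 IH2]]; first by rewrite addn0.
  rewrite addnS; have [_ []] := gz (n + k)%N => h1 h2 _ _ _.
  by split; [exact: le_trans h1|exact: le_trans IH2].
have mon2 : forall n k, (z n).2 <= (z (n + k)%N).2 /\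
    (z (n + k)%N).2 + L (n + k)%N <= (z n).2 + L n.
  move=> n; elim=> [|k [IH1 IH2]]; first by rewrite addn0.
  rewrite addnS; have [_ []] := gz (n + k)%N => _ _ h1 h2 _.
  by split; [exact: le_trans h1|exact: le_trans IH2].
(* Nested closed intervals meet: the supremum of the left endpoints lies below every right
   endpoint. *)
have nested (u V : nat -> R) : (forall n, 0 <= V n) ->
    (forall n k, u n <= u (n + k)%N /\ u (n + k)%N + V (n + k)%N <= u n + V n) ->
    exists r, forall n, u n <= r <= u n + V n.
  move=> V0 mon.
  have ub n m : u m <= u n + V n.
    have [nm|/ltnW mn] := leqP n m.
      have := (mon n (m - n)%N).2; rewrite subnKC//.
      by have := V0 m; lra.
    have := (mon m (n - m)%N).1; rewrite subnKC//.
    by have := V0 n; lra.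
  exists (sup (range u)) => n; apply/andP; split.
    apply: ub_le_sup; last by exists n.
    by exists (u 0%N + V 0%N) => _ [m _ <-].
  by apply: ge_sup => [|_ [m _ <-]//]; exists (u 0%N), 0%N.
have [a Ha] := nested (fun n => (z n).1) W W0 mon1.
have [b Hb] := nested (fun n => (z n).2) L L0 mon2.
have ax : x1 <= a <= x2.
  by have := Ha 0%N; rewrite /= /W expr0 divr1 xw.
(* With tolerance [c / (2 * S ^+ 2)] the local estimate at stage [n] is at most half of
   [c / 4 ^+ n], contradicting [good]. The summand 1 keeps [S] positive for a degenerate
   rectangle. *)
pose S := w + l + 1.
have S0 : 0 < S by rewrite /S; lra.
have [d d0 Hd] := @circulation_local a b ax (c / (2 * S ^+ 2))
  ltac:(by rewrite divr_gt0// mulr_gt0// exprn_gt0).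
have [n nd] : exists n, S / 2 ^+ n < d.
  have Sd : 0 < d / S by rewrite divr_gt0.
  have := @cvg_geometric R 1 (2^-1) ltac:(by rewrite ger0_norm; lra).
  move=> /cvgrPdist_lt/(_ _ Sd)[N _ /(_ N (leqnn N))]/=.
  rewrite sub0r normrN mul1r ger0_norm; last by rewrite exprn_ge0//; lra.
  rewrite ltr_pdivlMr// => H.
  by exists N; rewrite mulrC -exprVn.
have p2 : 0 < (2 : R) ^+ n by rewrite exprn_gt0.
have [[g1 g2 g3] _] := gz n.
have WS : W n < d.
  by apply: le_lt_trans nd; rewrite /W ler_pM2r ?invr_gt0// /S; lra.
have LS : L n < d.
  by apply: le_lt_trans nd; rewrite /L ler_pM2r ?invr_gt0// /S; lra.
have := Hd _ _ _ _ g1 g2 (Ha n) (Hb n) WS LS.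
move=> /(le_trans g3); apply/negP; rewrite -ltNge.
have -> : W n + L n = (w + l) / 2 ^+ n by rewrite /W /L mulrDl.
have -> : (4 : R) ^+ n = (2 ^+ n) ^+ 2.
  by rewrite exprAC; congr (_ ^+ n); ring.
rewrite expr_div_n mulrA ltr_pM2r ?invr_gt0 ?exprn_gt0//.
rewrite -ltr_pdivlMl ?divr_gt0 ?mulr_gt0 ?exprn_gt0//.
rewrite invf_div divfK ?gt_eqF//.
have : (w + l) ^+ 2 <= S ^+ 2 by rewrite ler_sqr ?nnegrE /S; lra.
have : 0 < S ^+ 2 by rewrite exprn_gt0.
lra.
Qed.

End Rectangle.
End ClosedForm.

(** * Integrals along the vertical lines of a strip *)

Section Plane.
Context {R : realType}.
Notation mu := (@lebesgue_measure R).
Notation plane := (measurableTypeR R * measurableTypeR R)%type.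

(** [U] is the union of the boxes with rational centre and radius [1 / (n + 1)] that it contains;
    there are countably many, and each is a measurable product. *)
Lemma box_open_measurable (U : set plane) :
  (forall z, U z -> exists2 e : R, 0 < e &
     forall s t, `|s - z.1| < e -> `|t - z.2| < e -> U (s, t)) ->
  measurable U.
Proof.
move=> oU.
pose box (i : rat * rat * nat) : set plane :=
  ball (ratr i.1.1 : R) i.2.+1%:R^-1 `*` ball (ratr i.1.2 : R) i.2.+1%:R^-1.
pose F i := if pselect (box i `<=` U) then box i else set0.
have -> : U = \bigcup_i F i.
  apply/seteqP; split => [[s t] /oU[e e0 eU]|z [i _]]; last first.
    by rewrite /F; case: pselect => [iU|?] // /iU.
  have [n ne] : exists n, n.+1%:R^-1 < e / 2 :> R.
    have e20 : 0 < e / 2 by rewrite divr_gt0.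
    by have [N _ /(_ N (leqnn N))] := near_infty_natSinv_lt (PosNum e20); exists N.
  have i0 : 0 < n.+1%:R^-1 :> R by rewrite invr_gt0.
  pose i : R := n.+1%:R^-1; rewrite -/i in ne i0.
  have [p ps] : exists p : rat, `|ratr p - s| < i.
    have /rat_in_itvoo[p] : s - i < s + i by lra.
    by rewrite in_itv/= => ?; exists p; rewrite ltr_norml; lra.
  have [q qt] : exists q : rat, `|ratr q - t| < i.
    have /rat_in_itvoo[q] : t - i < t + i by lra.
    by rewrite in_itv/= => ?; exists q; rewrite ltr_norml; lra.
  exists (p, q, n) => //; rewrite /F; case: pselect => [?|notU]; first by split.
  exfalso; apply: notU => z; rewrite /box /ball/= -/i => -[/= hs ht].
  rewrite (surjective_pairing z); apply: eU => /=.
    rewrite -(subrK (ratr p) z.1) -addrA (le_lt_trans (ler_normD _ _))// distrC.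
    lra.
  rewrite -(subrK (ratr q) z.2) -addrA (le_lt_trans (ler_normD _ _))// distrC.
  lra.
apply: countable_bigcupT_measurable; first exact: countableP.
move=> i; rewrite /F; case: pselect => [?|?] /=; last exact: measurable0.
by apply: measurableX; exact: measurable_ball.
Qed.

Lemma box_continuous_measurable (f : plane -> R) :
  (forall z (e : R), 0 < e -> exists2 d : R, 0 < d &
     forall s t, `|s - z.1| < d -> `|t - z.2| < d -> `|f (s, t) - f z| < e) ->
  measurable_fun setT f.
Proof.
move=> cf; apply: (measurability _ (RGenOpens.measurableE R)).
move=> _ [_ [a [b ->] <-]]; rewrite setTI; apply: box_open_measurable => z/=.
rewrite in_itv/= => /andP[az zb].
have e0 : 0 < Num.min (f z - a) (b - f z) by rewrite lt_min !subr_gt0 az.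
have [d d0 H] := cf z _ e0; exists d => // s t sd td.
have := H s t sd td; rewrite in_itv/= lt_min !ltr_norml => ?; lra.
Qed.

(** Otherwise [B] would be at least [e] on a set of infinite measure and its integral would be
    infinite. *)
Lemma infinite_measure_small (B : R -> \bar R) (D : set R) :
  measurable D -> mu D = +oo%E -> measurable_fun setT B ->
  (forall t, 0 <= B t)%E -> (\int[mu]_t B t < +oo)%E ->
  forall e : R, 0 < e -> exists2 t, D t & (B t < e%:E)%E.
Proof.
move=> mD Dy mB B0 By e e0; apply: contrapT => H.
suff : (+oo <= \int[mu]_t B t)%E by rewrite leNgt By.
have De t : D t -> (e%:E <= B t)%E.
  by move=> Dt; rewrite leNgt; apply/negP => Bt; apply: H; exists t.
apply: (@le_trans _ _ (\int[mu]_(t in D) B t)%E); last first.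
  by apply: ge0_subset_integral.
apply: (@le_trans _ _ (\int[mu]_(t in D) (cst e%:E t))%E).
  by rewrite integral_cst// [X in (_ * X)%E](_ : _ = +oo%E)// mulry gtr0_sg// mul1e.
apply: ge0_le_integral => //.
- by move=> t _ /=; rewrite lee_fin ltW.
- by apply: measurable_funS mB.
Qed.

(** Dominated convergence for the truncations of [w], dominated by [|w|]; at each [t] they are
    eventually equal to [w t]. *)
Lemma integral_exhaust (w : R -> R) (a b : nat -> R) :
  mu.-integrable setT (EFin \o w) ->
  (forall n, a n < - n%:R) -> (forall n, n%:R < b n) ->
  (fun n => \int[mu]_(t in `[a n, b n]) w t) @ \oo --> \int[mu]_t w t.
Proof.
move=> wi an bn.
pose f_ n (t : R) := ((w \_ `[a n, b n]) t)%:E.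
have mw : measurable_fun setT w by apply/measurable_EFinP; case/integrableP: wi.
have mf n : measurable_fun setT (f_ n).
  by apply/measurable_EFinP/measurable_restrict => //; exact: measurable_funTS.
have f_w t : f_ n t @[n --> \oo] --> (w t)%:E.
  apply: cvg_near_cst; exists (Num.bound `|t|) => // n /= tn.
  have tN := archi_boundP (normr_ge0 t).
  have {}tn : (Num.bound `|t|)%:R <= n%:R :> R by rewrite ler_nat.
  have [t1 t2] := (ler_norm t, ler_norm (- t)); rewrite normrN in t2.
  rewrite /f_ patchE mem_set//= in_itv/=.
  have := an n; have := bn n; lra.
have f_dom t n : (`|f_ n t| <= `|(w t)%:E|)%E.
  by rewrite /f_ patchE; case: ifP => // _; rewrite abse0.
have mw' : measurable_fun setT (EFin \o w) by exact/measurable_EFinP.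
have [|||_ _ cv] := @dominated_convergence _ _ R mu setT measurableT f_
  (EFin \o w) (abse \o (EFin \o w)) mf mw' => //.
- by apply: aeW.
- exact: integrable_abse.
- by apply: aeW.
have E n : (\int[mu]_t f_ n t)%E = (\int[mu]_(t in `[a n, b n]) (w t)%:E)%E.
  rewrite [RHS]integral_mkcond; apply: eq_integral => t _.
  by rewrite /f_ !patchE; case: ifP.
have fin : (\int[mu]_t (w t)%:E)%E \is a fin_num by exact: integrable_fin_num.
apply: fine_cvg; rewrite fineK//.
by under eq_fun do rewrite -E.
Qed.

Section StripIntegral.
Variables (P Q : R -> R -> R) (x1 x2 : R).
Hypothesis closedPQ : forall s t, x1 <= s <= x2 -> closed_at P Q s t.
Hypothesis lt12 : x1 < x2.
Variable M : R.
Hypothesis P_bound : forall s, x1 <= s <= x2 -> (\int[mu]_t `|P s t|%:E <= M%:E)%E.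
Hypothesis Q1_int : mu.-integrable setT (EFin \o Q x1).
Hypothesis Q2_int : mu.-integrable setT (EFin \o Q x2).

(* Clamping to [[x1, x2]] makes [P] continuous on the whole plane, whence its
   joint measurability. *)
Let cl (s : R) := Num.max x1 (Num.min s x2).

Let cl_in s : x1 <= cl s <= x2.
Proof. by rewrite /cl le_max lexx ge_max ge_min lexx orbT (ltW lt12). Qed.

Let cl_id s : x1 <= s <= x2 -> cl s = s.
Proof. by move=> /andP[h1 h2]; rewrite /cl min_l// max_r. Qed.

Let cl_lip s s' : `|cl s - cl s'| <= `|s - s'|.
Proof.
rewrite /cl ler_norml.
have := ler_norm (s - s'); have := ler_norm (s' - s).
rewrite distrC => h1 h2.
by apply/andP; split; rewrite /Num.max /Num.min; do ?case: ifPn; rewrite -?leNgt; lra.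
Qed.

Let G (z : plane) : \bar R := (\1_(`[x1, x2]%classic) z.1 * `|P (cl z.1) z.2|)%:E.

Let mG : measurable_fun setT G.
Proof.
apply/measurable_EFinP/measurable_funM => /=.
  apply: measurableT_comp; last exact: measurable_fst.
  exact: measurable_indic.
apply: box_continuous_measurable => -[s t] e e0 /=.
have [d [p [q [dP _]]]] := @closedPQ (cl s) t (cl_in s).
have [r r0 H] := diff_at2_locally_small dP e0.
exists r => // s' t' sr tr.
apply: le_lt_trans (ler_dist_dist _ _) _; apply: H => //.
exact: le_lt_trans (cl_lip _ _) _.
Qed.

Let G0 z : (0 <= G z)%E. Proof. by rewrite lee_fin mulr_ge0. Qed.

Let B t := (\int[mu]_s G (s, t))%E.

Let mB : measurable_fun setT B.
Proof. exact: (measurable_fun_fubini_tonelli_G (m1 := mu) _ mG). Qed.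

Let B0 t : (0 <= B t)%E. Proof. by apply: integral_ge0. Qed.

Let By : (\int[mu]_t B t < +oo)%E.
Proof.
rewrite /B -(fubini_tonelli (m1 := mu) (m2 := mu) G mG G0).
apply: (@le_lt_trans _ _ (\int[mu]_(s in `[x1, x2]) (cst M%:E s))%E).
  rewrite [leRHS]integral_mkcond; apply: ge0_le_integral => //.
  - by move=> s _; exact: integral_ge0.
  - exact: (measurable_fun_fubini_tonelli_F (m2 := mu) _ mG).
  - by apply/(measurable_restrictT _ _).1 => //; exact: measurable_cst.
  - move=> s _; rewrite patchE; case: ifPn => [|] sx.
      have sx' : x1 <= s <= x2 by move: sx; rewrite inE/= in_itv.
      apply: le_trans (P_bound sx').
      under eq_integral do rewrite /G /= indicE sx mul1r (cl_id sx').
      exact: lexx.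
    under eq_integral do rewrite /G /= indicE (negbTE sx) mul0r.
    by rewrite integral0.
rewrite integral_cst//= lebesgue_measure_itv/= lte_fin lt12.
by rewrite -EFinD -EFinM ltry.
Qed.

Let BE t : B t = (\int[mu]_(s in `[x1, x2]) `|P s t|%:E)%E.
Proof.
rewrite [RHS]integral_mkcond; apply: eq_integral => s _.
rewrite patchE /G indicE; case: ifPn => sx; last by rewrite mul0r.
by rewrite mul1r cl_id//; move: sx; rewrite inE/= in_itv.
Qed.

(* By Tonelli, [\int |P s t| ds] is integrable in [t], so it is arbitrarily small
   at suitable heights [a n < - n] and [b n > n]; the horizontal sides of the
   rectangles cut at these heights then contribute nothing in the limit. *)
Lemma strip_integral : \int[mu]_t Q x1 t = \int[mu]_t Q x2 t.
Proof.
have x12 : x1 <= x2 by exact: ltW.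
have contP t : {in `[x1, x2], continuous (P ^~ t)}.
  move=> s; rewrite in_itv/= => /(@closedPQ s t)[d [p [q [H _]]]].
  exact: diff_at2_continuous1 H.
have [a Ha] : {a : nat -> R & forall n, a n < - n%:R /\ (B (a n) < n.+1%:R^-1%:E)%E}.
  apply: (@choice _ _ (fun n x => x < - n%:R /\ (B x < n.+1%:R^-1%:E)%E)) => n.
  have my : mu `]-oo, (- n%:R)%R[%classic = +oo%E
    by rewrite lebesgue_measure_itv/= ?ltNyr ?ltry.
  have n0 : 0 < n.+1%:R^-1 :> R by rewrite invr_gt0.
  have [t] := infinite_measure_small (measurable_itv _) my mB B0 By n0.
  by rewrite /= in_itv/= => ? ?; exists t.
have [b Hb] : {b : nat -> R & forall n, n%:R < b n /\ (B (b n) < n.+1%:R^-1%:E)%E}.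
  apply: (@choice _ _ (fun n x => n%:R < x /\ (B x < n.+1%:R^-1%:E)%E)) => n.
  have my : mu `]n%:R, +oo[%classic = +oo%E
    by rewrite lebesgue_measure_itv/= ?ltNyr ?ltry.
  have n0 : 0 < n.+1%:R^-1 :> R by rewrite invr_gt0.
  have [t] := infinite_measure_small (measurable_itv _) my mB B0 By n0.
  by rewrite /= in_itv/= andbT => ? ?; exists t.
pose w t := Q x2 t - Q x1 t.
have wi : mu.-integrable setT (EFin \o w).
  have := integrableB measurableT Q2_int Q1_int.
  by apply: eq_integrable.
have cv := integral_exhaust wi (fun n => (Ha n).1) (fun n => (Hb n).1).
have Pabs t (e : R) : (B t < e%:E)%E -> `|\int[mu]_(s in `[x1, x2]) P s t| <= e.
  move=> Bt; have ci := segment_integrable (contP t).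
  apply: (le_trans (le_normr_Rintegral _ ci)) => //.
  rewrite -lee_fin /Rintegral fineK; first by rewrite -BE ltW.
  by rewrite -BE ge0_fin_numE// (lt_trans Bt) ?ltry.
(* The circulation around the rectangle between heights [a n] and [b n] vanishes, so the vertical
   sides are balanced by the two horizontal ones, each at most [n.+1%:R^-1] in absolute value. *)
have small n : `|\int[mu]_(t in `[a n, b n]) w t| <= 2 * n.+1%:R^-1.
  have [an Ban] := Ha n; have [bn Bbn] := Hb n.
  have ab : 0 <= b n - a n.
    by have : 0 <= n%:R :> R by []; lra.
  have := @circulation_closed R P Q x1 x2 closedPQ (a n) (x2 - x1) (b n - a n)
    ltac:(lra) ltac:(lra) ab.
  rewrite /circulation ![_ + (_ - _)]addrC !subrK => /eqP.
  rewrite addrC addr_eq0 => /eqP ->; rewrite normrN.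
  rewrite RintegralB//; try exact: segment_integrable.
  apply: (le_trans (ler_normB _ _)).
  by rewrite mulrDl mul1r lerD// ; [exact: Pabs Ban|exact: Pabs Bbn].
have cv0 : (fun n => \int[mu]_(t in `[a n, b n]) w t) @ \oo --> (0 : R).
  apply/cvgrPdist_le => e e0.
  have e20 : 0 < e / 2 by rewrite divr_gt0.
  have [N _ HN] := near_infty_natSinv_lt (PosNum e20).
  exists N => // n /HN /= ne; rewrite sub0r normrN (le_trans (small n))//.
  by rewrite mulrC -ler_pdivlMr// ltW.
have := cvg_unique _ cv cv0 => /= W0.
have : \int[mu]_t w t = 0 by exact: W0.
by rewrite /w RintegralB// => /eqP; rewrite subr_eq0 => /eqP.
Qed.

End StripIntegral.
End Plane.

(** * Complex derivatives *)

Section ComplexDerivative.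
Context {R : realType}.
Notation C := R[i].
Notation normc := (@Normc.normc R).
Implicit Types (f g : C -> C) (z D : C).

(** Complex differentiability with real tolerances and the real-valued modulus [normc], whereas
    [derivable] measures sizes in [C]. *)
Definition cdiff f z D := forall e : R, 0 < e ->
  exists2 d : R, 0 < d & forall h, normc h < d ->
    normc (f (z + h) - f z - D * h) <= e * normc h.

Lemma derivable_cdiff f z :
  derivable (f : C^o -> C^o) z 1 -> exists D, cdiff f z D.
Proof.
move=> /derivable_nbhsP/eqaddoP H.
exists ('D_1 (f : C^o -> C^o) z) => e e0.
have e0' : 0 < e%:C by rewrite ltcR.
have [d /= d0 Hd] := H _ e0'.
exists (complex.Re d).
  by move: d0; rewrite ltcE/= => /andP[].
move=> h hd.
have dE : d = (complex.Re d)%:C.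
  by move: d0; case: (d) => a b; rewrite ltcE/= => /andP[/eqP -> _].
have := Hd h; rewrite /ball_/= sub0r normrN dE.
have -> : (`|h : C^o| < (complex.Re d)%:C) by rewrite ltcR.
move=> /(_ isT); rewrite -lecR rmorphM/=.
rewrite /= !fctE/= => H1; apply: le_trans H1.
rewrite le_eqVlt; apply/orP; left; apply/eqP.
congr (normc _)%:C.
rewrite [h *: 1]mulr1 [h *: _]mulrC opprD addrA [z + h]addrC.
by [].
Qed.

Lemma cdiff_derivable f z D :
  cdiff f z D -> derivable (f : C^o -> C^o) z 1.
Proof.
move=> H; apply/cvg_ex; exists (D : C^o); apply/cvgrPdist_le => /= e e0.
have eE : e = (complex.Re e)%:C.
  by move: e0; case: (e) => a b; rewrite ltcE/= => /andP[/eqP -> _].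
have e0' : 0 < complex.Re e by move: e0; rewrite ltcE/= => /andP[].
have [d d0 Hd] := H _ e0'.
exists d%:C => /=; first by rewrite ltcR.
move=> h; rewrite /ball_/= sub0r normrN => hd h0.
have {}hd : normc h < d by rewrite -ltcR.
have := Hd h hd; rewrite -lecR rmorphM /= -eE => H1.
rewrite [h *: 1]mulr1 [h + z]addrC.
have -> : D - h^-1 *: (f (z + h) - f z) = - (h^-1 * (f (z + h) - f z - D * h)).
  rewrite /GRing.scale/=; field; exact: h0.
have hp : 0 < `|h| by rewrite normr_gt0.
rewrite normrN normrM normfV ler_pdivrMl// [_ * e]mulrC.
exact: H1.
Qed.

Lemma cdiff_mul f g z Df Dg : cdiff f z Df -> cdiff g z Dg ->
  exists D, cdiff (fun w => f w * g w) z D.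
Proof.
move=> /cdiff_derivable df /cdiff_derivable dg.
exact: derivable_cdiff (derivableM df dg).
Qed.

Lemma cdiff_lin f g z Df Dg (c : C) : cdiff f z Df -> cdiff g z Dg ->
  exists D, cdiff (fun w => c * f w + g w) z D.
Proof.
move=> /cdiff_derivable df /cdiff_derivable dg.
exact: derivable_cdiff (derivableD (derivableZ (k := c) df) dg).
Qed.

Lemma normc_conj z : normc (conjc z) = normc z.
Proof. by case: z => a b /=; rewrite sqrrN. Qed.

(** The conjugations inside and outside compensate. This is how a conjugate of [g] can enter a
    holomorphic integrand. *)
Lemma cdiff_reflect g z (c : C) D : cdiff g (c - conjc z) D ->
  cdiff (fun w => conjc (g (c - conjc w))) z (- conjc D).
Proof.
move=> H e e0; have [d d0 Hd] := H e e0.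
exists d => // h hd.
have hN : normc (- conjc h) = normc h by rewrite normcN normc_conj.
have := Hd (- conjc h); rewrite hN => /(_ hd).
rewrite -normc_conj !(rmorphB, rmorphM, rmorphN, rmorphD)/= !conjcK opprD addrA.
by rewrite mulNr mulrN.
Qed.

Lemma cdiff_affine f z (a b : C) D : cdiff f (a * z + b) D ->
  cdiff (fun w => f (a * w + b)) z (D * a).
Proof.
move=> H e e0.
have K0 : 0 < normc a + 1.
  have : 0 <= normc a by rewrite -lecR; exact: (normr_ge0 a).
  lra.
have eK0 : 0 < e / (normc a + 1) by rewrite divr_gt0.
have [d d0 Hd] := H _ eK0.
exists (d / (normc a + 1)); first by rewrite divr_gt0.
move=> h hd.
have h0 : 0 <= normc h by rewrite -lecR; exact: (normr_ge0 h).
have a0 : 0 <= normc a by rewrite -lecR; exact: (normr_ge0 a).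
have ha : normc (a * h) < d.
  rewrite Normc.normcM; move: hd; rewrite ltr_pdivlMr// => hd; nra.
have -> : a * (z + h) + b = a * z + b + a * h by ring.
rewrite -mulrA; apply: le_trans (Hd _ ha) _.
rewrite Normc.normcM mulrAC ler_pdivrMr// -mulrA.
apply: ler_wpM2l; first exact: ltW.
by rewrite mulrC ler_wpM2l// lerDl.
Qed.

(** Serves for functions cut off to 0 outside the half-plane: near a point of the half-plane the
    cut-off is invisible. *)
Lemma cdiff_local f g z D : (exists2 d : R, 0 < d &
    forall h, normc h < d -> f (z + h) = g (z + h)) ->
  cdiff g z D -> cdiff f z D.
Proof.
move=> [r r0 fg] H e e0; have [d d0 Hd] := H e e0.
exists (Num.min r d); first by rewrite lt_min r0.
move=> h; rewrite lt_min => /andP[hr hd].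
have f0 : f z = g z.
  by have := fg 0; rewrite addr0; apply; rewrite Normc.normc0.
by rewrite fg// f0; exact: Hd.
Qed.

Lemma normc_le_abs (a b : R) : normc (a +i* b) <= `|a| + `|b|.
Proof.
rewrite /= -[leRHS]ger0_norm ?addr_ge0//.
rewrite -sqrtr_sqr ler_wsqrtr// sqrrD !real_normK ?num_real//.
by rewrite -addrA lerD2l lerDr mulrn_wge0// mulr_ge0.
Qed.

Lemma Re_le_normc z : `|complex.Re z| <= normc z.
Proof. by case: z => a b /=; rewrite -sqrtr_sqr ler_wsqrtr// lerDl sqr_ge0. Qed.

Lemma Im_le_normc z : `|complex.Im z| <= normc z.
Proof. by case: z => a b /=; rewrite -sqrtr_sqr ler_wsqrtr// lerDr sqr_ge0. Qed.

(* The Cauchy-Riemann equations: [Im f ds + Re f dt] is a closed form. *)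
Lemma cdiff_closed f (x y : R) D : cdiff f (x +i* y) D ->
  closed_at (fun s t => complex.Im (f (s +i* t)))
            (fun s t => complex.Re (f (s +i* t))) x y.
Proof.
case: D => A B H; exists A, B, (- B).
have K : forall e : R, 0 < e -> exists2 d : R, 0 < d & forall s t,
    `|s - x| < d -> `|t - y| < d ->
    normc (f (s +i* t) - f (x +i* y) - (A +i* B) * ((s - x) +i* (t - y)))
      <= e * (`|s - x| + `|t - y|).
  move=> e e0; have [d d0 Hd] := H e e0.
  exists (d / 2); first by rewrite divr_gt0.
  move=> s t sd td.
  have hd : normc ((s - x) +i* (t - y)) < d.
    by apply: (le_lt_trans (normc_le_abs _ _)); lra.
  have := Hd _ hd.
  have -> : (x +i* y) + ((s - x) +i* (t - y)) = s +i* t.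
    by apply/eqP; rewrite eq_complex /=; apply/andP; split; apply/eqP; ring.
  move=> /le_trans; apply.
  by apply: ler_wpM2l; [exact: ltW|exact: normc_le_abs].
split=> e /K[d d0 Hd]; exists d => // s t sd td; apply: le_trans (Hd s t sd td).
- apply: le_trans (Im_le_normc _); rewrite le_eqVlt; apply/orP; left; apply/eqP.
  congr (`|_|); case: (f _) => ? ?; case: (f _) => ? ? /=; ring.
- apply: le_trans (Re_le_normc _); rewrite le_eqVlt; apply/orP; left; apply/eqP.
  congr (`|_|); case: (f _) => ? ?; case: (f _) => ? ? /=; ring.
Qed.

Lemma cdiff_continuous_line f (x : R) :
  (forall y, exists D, cdiff f (x +i* y) D) ->
  continuous (fun y => complex.Re (f (x +i* y))) /\
  continuous (fun y => complex.Im (f (x +i* y))).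
Proof.
move=> H; split=> y; have [D /cdiff_closed[d [p [q [d1 d2]]]]] := H y.
  exact: (diff_at2_continuous2 d2).
exact: (diff_at2_continuous2 d1).
Qed.

End ComplexDerivative.

(** * Affine substitution *)

Section AffineSubstitution.
Context {R : realType}.
Notation mu := (@lebesgue_measure R).
Variables (a c : R).
Hypothesis a0 : 0 < a.

Let derive_affine : derive1 (fun t : R => a * t + c) = cst a.
Proof.
apply/funext => x; rewrite derive1E.
have -> : (fun t : R => a * t + c) = (a \*: (@id R^o)) + cst c by [].
rewrite deriveD; [|apply: derivableZ; exact: derivable_id|exact: derivable_cst].
by rewrite deriveZ; last exact: derivable_id; rewrite derive_id derive_cst addr0 /GRing.scale/= mulr1.
Qed.

Lemma ge0_integral_affine (F : R -> R) : continuous F -> (forall t, 0 <= F t) ->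
  (\int[mu]_t (F (a * t + c))%:E = a^-1%:E * \int[mu]_t (F t)%:E)%E.
Proof.
move=> cF F0.
have cFa : continuous (fun t => F (a * t + c)).
  move=> x; apply: continuous_comp; last exact: cF.
  by apply: cvgD; [apply: cvgM; [exact: cvg_cst|exact: cvg_id]|exact: cvg_cst].
rewrite (@increasing_ge0_integration_by_substitutionT R (fun t => a * t + c) F)//.
- rewrite derive_affine.
  under [in RHS]eq_integral do rewrite fctE/= EFinM.
  rewrite ge0_integralZr//; last 3 first.
  + by apply/measurable_EFinP; exact: continuous_measurable_fun cFa.
  + by move=> t _; rewrite lee_fin.
  + by rewrite lee_fin ltW.
  + by rewrite [(_ * a%:E)%E]muleC muleA -EFinM mulVf ?gt_eqF// mul1e.
- by move=> x y xy; rewrite ltrD2r ltr_pM2l.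
- by rewrite derive_affine => x; exact: cvg_cst.
- by rewrite derive_affine; exact: is_cvg_cst.
- by rewrite derive_affine; exact: is_cvg_cst.
- apply/cvgrNyPle => A; near=> x; rewrite -lerBrDr mulrC -(ler_pdivlMr _ _ a0).
  by near: x; apply: nbhs_ninfty_le; rewrite num_real.
- apply/cvgryPge => A; near=> x; rewrite -lerBlDr mulrC -(ler_pdivrMr _ _ a0).
  by near: x; apply: nbhs_pinfty_ge; rewrite num_real.
Unshelve. all: end_near. Qed.

(** The nonnegative case applies to the positive and the negative part; integrability of [F] lets
    [a^-1] be factored out of their difference. *)
Lemma Rintegral_affine (F : R -> R) : continuous F ->
  mu.-integrable setT (EFin \o F) ->
  \int[mu]_t F (a * t + c) = a^-1 * \int[mu]_t F t.
Proof.
move=> cF iF; rewrite /Rintegral.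
have pos (G : R -> R) : continuous G -> continuous (fun t => Num.max (G t) 0).
  by move=> cG x; apply: continuous_max; [exact: cG|exact: cvg_cst].
have posE (G : R -> R) : (\int[mu]_t (fun x => (G x)%:E)^\+ t =
    \int[mu]_t (Num.max (G t) 0)%:E)%E.
  by apply: eq_integral => t _; rewrite funeposE EFin_max.
have negE (G : R -> R) : (\int[mu]_t (fun x => (G x)%:E)^\- t =
    \int[mu]_t (Num.max (- G t) 0)%:E)%E.
  by apply: eq_integral => t _; rewrite funenegE -EFinN EFin_max.
have -> : (\int[mu]_t (F (a * t + c))%:E = a^-1%:E * \int[mu]_t (F t)%:E)%E.
  rewrite [LHS]integralE [in RHS]integralE.
  have E1 : (\int[mu]_t (fun x => (F (a * x + c))%:E)^\+ t =
      a^-1%:E * \int[mu]_t (fun x => (F x)%:E)^\+ t)%E.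
    rewrite (posE (fun t => F (a * t + c))) (posE F).
    by apply: (ge0_integral_affine (pos _ cF)) => t; rewrite le_max lexx orbT.
  have E2 : (\int[mu]_t (fun x => (F (a * x + c))%:E)^\- t =
      a^-1%:E * \int[mu]_t (fun x => (F x)%:E)^\- t)%E.
    rewrite (negE (fun t => F (a * t + c))) (negE F).
    have cN : continuous (fun t => - F t) by move=> x; apply: cvgN; exact: cF.
    by apply: (ge0_integral_affine (pos _ cN)) => t; rewrite le_max lexx orbT.
  rewrite E1 E2 [RHS]muleBr//.
  by apply: fin_num_adde_defl; rewrite fin_numN; exact: integrable_neg_fin_num iF.
by rewrite fineM// integrable_fin_num.
Qed.

End AffineSubstitution.

(** * The Hardy space *)

Section HardyMeans.
Context {R : realType}.
Notation C := R[i].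
Notation mu := (@lebesgue_measure R).
Implicit Types (f g : C -> C^o) (x y : R).

(* The real part of [u * conj v]. *)
Definition cip (u v : C) : R :=
  complex.Re u * complex.Re v + complex.Im u * complex.Im v.

(** Square integrability on the line [Re z = x]; continuity is included to provide measurability and
    to allow affine substitution. *)
Definition L2_on_line f x :=
  [/\ continuous (fun y => complex.Re (f (x +i* y))),
      continuous (fun y => complex.Im (f (x +i* y))) &
      mu.-integrable setT (EFin \o (fun y => cip (f (x +i* y)) (f (x +i* y))))].

(** The real part of the normalized L^2 inner product of [f] on the line [Re z = x] and [g] on the
    line [Re z = x']. Allowing two different lines is what makes the shift invariance expressible;
    [line_mean] is the [m f] of the introductory comment. *)
Definition line_ip f g x x' : R :=
  pi^-1 * \int[mu]_y cip (f (x +i* y)) (g (x' +i* y)).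

Definition line_mean f x : R := line_ip f f x x.

Lemma cip_ge0 (u : C) : 0 <= cip u u.
Proof. by rewrite addr_ge0// -expr2 sqr_ge0. Qed.

Lemma cip_norm (u : C) : complex.Re `|u| ^+ 2 = cip u u.
Proof. by rewrite normc_def /= sqr_sqrtr ?addr_ge0 ?sqr_ge0// /cip !expr2. Qed.

(** This pointwise bound plays the part of the Cauchy-Schwarz inequality: it yields integrability of
    products and midpoint convexity. *)
Lemma cip_AMGM (u v : C) : `|cip u v| <= (cip u u + cip v v) / 2.
Proof.
rewrite ler_norml /cip; case: u => a b; case: v => c d /=.
have := sqr_ge0 (a - c); have := sqr_ge0 (b - d).
have := sqr_ge0 (a + c); have := sqr_ge0 (b + d).
by rewrite !expr2; lra.
Qed.

Lemma line_mean_ge0 f x : 0 <= line_mean f x.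
Proof.
rewrite mulr_ge0 ?invr_ge0 ?pi_ge0//.
by apply: Rintegral_ge0 => y _; exact: cip_ge0.
Qed.

Lemma cip_continuous f g x x' : L2_on_line f x -> L2_on_line g x' ->
  continuous (fun y => cip (f (x +i* y)) (g (x' +i* y))).
Proof.
move=> [fr fi _] [gr gi _] y; apply: cvgD; apply: cvgM;
  [exact: fr|exact: gr|exact: fi|exact: gi].
Qed.

Lemma cip_integrable f g x x' : L2_on_line f x -> L2_on_line g x' ->
  mu.-integrable setT (EFin \o (fun y => cip (f (x +i* y)) (g (x' +i* y)))).
Proof.
move=> Lf Lg; have cfg := cip_continuous Lf Lg.
have [[_ _ If] [_ _ Ig]] := (Lf, Lg).
have I := integrableZl measurableT 2^-1 (integrableD measurableT If Ig).
apply: le_integrable I => //.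
  by apply/measurable_EFinP; exact: continuous_measurable_fun.
move=> y _ /=; rewrite lee_fin; apply: le_trans (cip_AMGM _ _) _.
by rewrite mulrC ler_norm.
Qed.

Lemma L2_on_lineD f g x : L2_on_line f x -> L2_on_line g x ->
  L2_on_line (f + g) x.
Proof.
move=> Lf Lg; have [[fr fi _] [gr gi _]] := (Lf, Lg).
split.
- rewrite (_ : (fun y => _) =
    (fun y => complex.Re (f (x +i* y)) + complex.Re (g (x +i* y)))).
    by move=> y; apply: cvgD; [exact: fr|exact: gr].
  by apply/funext => y; rewrite fctE; case: (f _) => ? ?; case: (g _).
- rewrite (_ : (fun y => _) =
    (fun y => complex.Im (f (x +i* y)) + complex.Im (g (x +i* y)))).
    by move=> y; apply: cvgD; [exact: fi|exact: gi].
  by apply/funext => y; rewrite fctE; case: (f _) => ? ?; case: (g _).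
- have [Iff Igg] := (cip_integrable Lf Lf, cip_integrable Lg Lg).
  have Ifg := cip_integrable Lf Lg.
  have I := integrableD measurableT (integrableD measurableT Iff Igg)
    (integrableD measurableT Ifg Ifg).
  apply: eq_integrable I => //= y _; rewrite -!EFinD; congr EFin.
  rewrite /cip !fctE.
  by case: (f _) => ? ?; case: (g _) => ? ? /=; ring.
Qed.

Lemma line_meanD f g x : L2_on_line f x -> L2_on_line g x ->
  line_mean (f + g) x = line_mean f x + line_mean g x + 2 * line_ip f g x x.
Proof.
move=> Lf Lg; have [Iff Igg] := (cip_integrable Lf Lf, cip_integrable Lg Lg).
have Ifg := cip_integrable Lf Lg.
rewrite /line_mean /line_ip mulrCA -!mulrDr; congr (_ * _).
rewrite -RintegralZl// -RintegralD// -RintegralD//; last 2 first.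
- exact: (integrableD measurableT Iff Igg).
- exact: (integrableZl measurableT 2 Ifg).
congr Rintegral; apply/funext => y; rewrite /cip !fctE.
by case: (f _) => ? ?; case: (g _) => ? ? /=; ring.
Qed.

Lemma L2_on_lineZ (c : C) f x : L2_on_line f x -> L2_on_line (c *: f) x.
Proof.
move=> Lf; have [fr fi If] := Lf; case: c => a b.
split.
- rewrite (_ : (fun y => _) =
    (fun y => a * complex.Re (f (x +i* y)) - b * complex.Im (f (x +i* y)))).
    by move=> y; apply: cvgB; apply: cvgM; [exact: cvg_cst|exact: fr|exact: cvg_cst|exact: fi].
  by apply/funext => y; rewrite fctE; case: (f _).
- rewrite (_ : (fun y => _) =
    (fun y => a * complex.Im (f (x +i* y)) + b * complex.Re (f (x +i* y)))).
    by move=> y; apply: cvgD; apply: cvgM; [exact: cvg_cst|exact: fi|exact: cvg_cst|exact: fr].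
  by apply/funext => y; rewrite fctE; case: (f _).
- have I := integrableZl measurableT (a ^+ 2 + b ^+ 2) If.
  apply: eq_integrable I => //= y _; rewrite -EFinM; congr EFin.
  by rewrite /cip !fctE; case: (f _) => ? ? /=; ring.
Qed.

Lemma line_meanZ (c : C) f x : L2_on_line f x ->
  line_mean (c *: f) x = cip c c * line_mean f x.
Proof.
move=> Lf; rewrite /line_mean /line_ip mulrCA; congr (_ * _).
rewrite -RintegralZl//; last exact: cip_integrable.
congr Rintegral; apply/funext => y; rewrite /cip !fctE.
by case: c => ? ?; case: (f _) => ? ? /=; ring.
Qed.

Lemma line_ip_affine f g f' g' x x' u u' (a c : R) : 0 < a ->
  L2_on_line f u -> L2_on_line g u' ->
  (forall y, f' (x +i* y) = f (u +i* (a * y + c))) ->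
  (forall y, g' (x' +i* y) = g (u' +i* (a * y + c))) ->
  line_ip f' g' x x' = a^-1 * line_ip f g u u'.
Proof.
move=> a0 Lf Lg ff gg; rewrite /line_ip mulrCA; congr (_ * _).
under eq_Rintegral do rewrite ff gg.
exact: (Rintegral_affine c a0 (cip_continuous Lf Lg) (cip_integrable Lf Lg)).
Qed.

Lemma L2_on_line_affine f f' x u (a c : R) : 0 < a -> L2_on_line f u ->
  (forall y, f' (x +i* y) = f (u +i* (a * y + c))) -> L2_on_line f' x.
Proof.
move=> a0 Lf ff; have [fr fi If] := Lf.
have ca : continuous (fun y => a * y + c).
  by move=> y; apply: cvgD; [apply: cvgM; [exact: cvg_cst|exact: cvg_id]|exact: cvg_cst].
have cr : continuous (fun y => complex.Re (f' (x +i* y))).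
  under eq_fun do rewrite ff.
  by move=> y; apply: (@continuous_comp _ _ _ (fun y => a * y + c)
    (fun t => complex.Re (f (u +i* t))) y); [exact: ca|exact: fr].
have ci : continuous (fun y => complex.Im (f' (x +i* y))).
  under eq_fun do rewrite ff.
  by move=> y; apply: (@continuous_comp _ _ _ (fun y => a * y + c)
    (fun t => complex.Im (f (u +i* t))) y); [exact: ca|exact: fi].
split => //; apply/integrableP; split.
  apply/measurable_EFinP; apply: continuous_measurable_fun => y.
  by apply: cvgD; apply: cvgM; [exact: cr|exact: cr|exact: ci|exact: ci].
under eq_integral do rewrite /= ger0_norm ?cip_ge0// ff.
have := @ge0_integral_affine R a c a0 (fun t => cip (f (u +i* t)) (f (u +i* t)))
  (cip_continuous Lf Lf) (fun t => cip_ge0 _).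
move=> /= ->; rewrite lte_mul_pinfty ?lee_fin ?invr_ge0 ?(ltW a0)//.
case/integrableP : If => _; apply: le_lt_trans; rewrite le_eqVlt; apply/orP; left.
by apply/eqP; apply: eq_integral => y _ /=; rewrite ger0_norm ?cip_ge0.
Qed.

End HardyMeans.

Section HardySpace.
Context {R : realType}.
Notation C := R[i].
Notation mu := (@lebesgue_measure R).
Notation N := (@hardy_norm R).
Implicit Types (f g : C -> C^o) (x y : R).

Lemma hardy2_cdiff f z : hardy2 R f -> 0 < complex.Re z -> exists D, cdiff f z D.
Proof. by move=> [df _ _] z0; apply: derivable_cdiff; exact: df. Qed.

Let sqnormE f x : (\int[mu]_(y in [set: R])
      ((complex.Re `|f (x +i* y)| ^+ 2)%R)%:E =
  \int[mu]_y (cip (f (x +i* y)) (f (x +i* y)))%:E)%E.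
Proof. by apply: eq_integral => y _; rewrite cip_norm. Qed.

(** Holomorphy gives continuity. The integral is finite because its positive multiple by [1 / pi] is
    one of the values whose supremum is finite. *)
Lemma hardy2_line f x : hardy2 R f -> 0 < x -> L2_on_line f x.
Proof.
move=> Hf x0; have [cr ci] := @cdiff_continuous_line R f x
  (fun y => @hardy2_cdiff f (x +i* y) Hf x0).
split => //; apply/integrableP; split.
  apply/measurable_EFinP; apply: continuous_measurable_fun => y.
  by apply: cvgD; apply: cvgM; [exact: cr|exact: cr|exact: ci|exact: ci].
under eq_integral do rewrite /= ger0_norm ?cip_ge0//.
have [_ _ fy] := Hf.
have : ((pi^-1)%:E * \int[mu]_y (cip (f (x +i* y)) (f (x +i* y)))%:E < +oo)%E.
  apply: le_lt_trans fy; apply: ereal_sup_ubound; exists x => //.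
  by rewrite sqnormE.
have pi0 : 0 < (pi : R)^-1 by rewrite invr_gt0 pi_gt0.
case: (X in (_ * X < _)%E) => [r| |].
- by move=> _; exact: ltry.
- by rewrite gt0_muley// lte_fin.
- by [].
Qed.

Let lineE f x : hardy2 R f -> 0 < x ->
  ((pi^-1)%:E * \int[mu]_(y in [set: R])
      ((complex.Re `|f (x +i* y)| ^+ 2)%R)%:E = (line_mean f x)%:E)%E.
Proof.
move=> Hf x0; rewrite sqnormE /line_mean /line_ip EFinM; congr (_ * _)%E.
by rewrite fineK// integrable_fin_num//; have [] := hardy2_line Hf x0.
Qed.

Let sqnorm_ge f x : hardy2 R f -> 0 < x ->
  ((line_mean f x)%:E <= hardy_sqnorm f)%E.
Proof.
by move=> Hf x0; apply: ereal_sup_ubound; exists x => //; rewrite lineE.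
Qed.

Let hardy_norm_sq f : hardy2 R f -> (N f ^+ 2)%:E = hardy_sqnorm f.
Proof.
move=> Hf; have [_ _ fy] := Hf.
have f0 : (0 <= hardy_sqnorm f)%E.
  by apply: le_trans (sqnorm_ge Hf ltr01); rewrite lee_fin line_mean_ge0.
rewrite /hardy_norm sqr_sqrtr ?fine_ge0// fineK// ge0_fin_numE//.
Qed.

Lemma line_mean_le f x : hardy2 R f -> 0 < x -> line_mean f x <= N f ^+ 2.
Proof. by move=> Hf x0; rewrite -lee_fin hardy_norm_sq//; exact: sqnorm_ge. Qed.

Lemma hardy_norm_le f (B : R) : hardy2 R f ->
  (forall x, 0 < x -> line_mean f x <= B) -> N f ^+ 2 <= B.
Proof.
move=> Hf fB; rewrite -lee_fin hardy_norm_sq//; apply: ge_ereal_sup.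
by move=> _ [x /= x0 <-]; rewrite lineE// lee_fin fB.
Qed.

Lemma hardy2_intro f (M : R) :
  (forall z, 0 < complex.Re z -> exists D, cdiff f z D) ->
  (forall z, ~ 0 < complex.Re z -> f z = 0) ->
  (forall x, 0 < x -> L2_on_line f x) ->
  (forall x, 0 < x -> line_mean f x <= M) -> hardy2 R f.
Proof.
move=> df f0 Lf fM; split => //.
  by move=> z /df[D]; exact: cdiff_derivable.
apply: (@le_lt_trans _ _ M%:E); last by rewrite ltry.
apply: ge_ereal_sup => _ [x /= x0 <-]; rewrite sqnormE.
have := fM x x0; rewrite -lee_fin; apply: le_trans.
rewrite /line_mean /line_ip EFinM fineK//.
by rewrite integrable_fin_num//; have [] := Lf x x0.
Qed.

Lemma hardy_norm_ge0 f : 0 <= N f.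
Proof. exact: sqrtr_ge0. Qed.

Lemma hardy2_lin (c : C) f g : hardy2 R f -> hardy2 R g -> hardy2 R (c *: f + g).
Proof.
move=> Hf Hg.
have L x : 0 < x -> L2_on_line (c *: f) x.
  by move=> x0; apply: L2_on_lineZ; exact: hardy2_line.
(* The constant comes from [|u + v|^2 <= 2 |u|^2 + 2 |v|^2]. *)
apply: (@hardy2_intro _ (2 * (cip c c * N f ^+ 2 + N g ^+ 2))).
- move=> z z0; have [Df df] := hardy2_cdiff Hf z0.
  by have [Dg dg] := hardy2_cdiff Hg z0; exact: cdiff_lin df dg.
- have [[_ f0 _] [_ g0 _]] := (Hf, Hg).
  by move=> z nz; rewrite !fctE f0// g0// scaler0 addr0.
- by move=> x x0; apply: L2_on_lineD; [exact: L|exact: hardy2_line].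
- move=> x x0; have [L1 Lg] := (L x x0, hardy2_line Hg x0).
  rewrite line_meanD//.
  have := line_mean_le Hf x0; have := line_mean_le Hg x0.
  have E := line_meanZ c (hardy2_line Hf x0).
  move=> g1 f1; have : line_mean (c *: f) x <= cip c c * N f ^+ 2.
    by rewrite E; apply: ler_wpM2l => //; exact: cip_ge0.
  suff : 2 * line_ip (c *: f) g x x <= line_mean (c *: f) x + line_mean g x by lra.
  rewrite /line_mean /line_ip mulrCA -mulrDr.
  apply: ler_wpM2l; first by rewrite invr_ge0 pi_ge0.
  have [If Ig] := (cip_integrable L1 L1, cip_integrable Lg Lg).
  rewrite -RintegralD// -RintegralZl//; last exact: cip_integrable.
  apply: le_Rintegral => //.
  + exact: (integrableZl measurableT 2 (cip_integrable L1 Lg)).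
  + exact: (integrableD measurableT If Ig).
  + move=> y _; have := cip_AMGM ((c *: f) (x +i* y)) (g (x +i* y)).
    by rewrite ler_norml; lra.
Qed.

End HardySpace.

(** * Shift invariance of line products, and the norm as a boundary limit *)

Section HardyShift.
Context {R : realType}.
Notation C := R[i].
Notation mu := (@lebesgue_measure R).
Notation N := (@hardy_norm R).
Implicit Types (f g : C -> C^o) (x y : R).

(** An instance of [strip_integral] with [P] and [Q] the imaginary and real parts of the holomorphic
    [h]. The Hardy norms of [f] and [g] bound the integral of [|P|] uniformly over the lines of the
    strip. *)
Lemma line_ip_shift f g x1 x2 x1' x2' : hardy2 R f -> hardy2 R g ->
  0 < x1 -> 0 < x2 -> 0 < x1' -> 0 < x2' -> x1 + x2 = x1' + x2' ->
  line_ip f g x1 x2 = line_ip f g x1' x2'.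
Proof.
move=> Hf Hg; wlog lt1 : x1 x2 x1' x2' / x1 < x1'.
  move=> H h1 h2 h1' h2' E; case: (ltgtP x1 x1') => [lt|gt|E1].
  - exact: H.
  - by apply/esym/H.
  - by congr line_ip => //; apply: (addrI x1); rewrite E E1.
move=> h1 h2 h1' h2' E; rewrite /line_ip; congr (_ * _).
pose h (z : C) : C := f z * conjc (g ((x1 + x2)%:C - conjc z)).
(* The reflection keeps the height [t], so on the line [Re z = s] the real part of [h] is exactly
   the integrand pairing the abscissas [s] and [x1 + x2 - s]. *)
have arg s t : (x1 + x2)%:C - conjc (s +i* t) = (x1 + x2 - s) +i* t.
  by apply/eqP; rewrite eq_complex /= sub0r opprK !eqxx.
have hRe s t : complex.Re (h (s +i* t)) =
    cip (f (s +i* t)) (g ((x1 + x2 - s) +i* t)).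
  rewrite /h arg /cip; case: (f _) => ? ?; case: (g _) => ? ? /=; ring.
have hIm s t : complex.Im (h (s +i* t)) =
    complex.Im (f (s +i* t)) * complex.Re (g ((x1 + x2 - s) +i* t)) -
    complex.Re (f (s +i* t)) * complex.Im (g ((x1 + x2 - s) +i* t)).
  rewrite /h arg; case: (f _) => ? ?; case: (g _) => ? ? /=; ring.
have closed s t : x1 <= s <= x1' -> closed_at
    (fun s t => complex.Im (h (s +i* t))) (fun s t => complex.Re (h (s +i* t))) s t.
  move=> sx; have s0 : 0 < s by lra.
  have s0' : 0 < x1 + x2 - s by lra.
  have [Df df] := @hardy2_cdiff _ f (s +i* t) Hf s0.
  have [Dg dg] := @hardy2_cdiff _ g ((x1 + x2 - s) +i* t) Hg s0'.
  rewrite -arg in dg.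
  have [D dh] := cdiff_mul df (cdiff_reflect dg).
  exact: cdiff_closed dh.
have Lf s : x1 <= s <= x1' -> L2_on_line f s.
  by move=> ?; apply: hardy2_line => //; lra.
have Lg s : x1 <= s <= x1' -> L2_on_line g (x1 + x2 - s).
  by move=> ?; apply: hardy2_line => //; lra.
have bound s : x1 <= s <= x1' ->
    (\int[mu]_t `|complex.Im (h (s +i* t))|%:E <=
     (pi * ((N f ^+ 2 + N g ^+ 2) / 2))%:E)%E.
  move=> sx; have [L1 L2] := (Lf s sx, Lg s sx).
  have [If Ig] := (cip_integrable L1 L1, cip_integrable L2 L2).
  have I := integrableZl measurableT 2^-1 (integrableD measurableT If Ig).
  have [fr fi _] := L1; have [gr gi _] := L2.
  apply: (@le_trans _ _ (\int[mu]_t (2^-1 *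
     (cip (f (s +i* t)) (f (s +i* t)) +
      cip (g ((x1 + x2 - s) +i* t)) (g ((x1 + x2 - s) +i* t))))%:E)%E).
    apply: ge0_le_integral => //.
    - apply/measurable_EFinP; apply: measurableT_comp => //.
      under eq_fun do rewrite hIm.
      apply: continuous_measurable_fun => t.
      by apply: cvgB; apply: cvgM; [exact: fi|exact: gr|exact: fr|exact: gi].
    - apply/measurable_EFinP; case/integrableP : I => /measurable_EFinP.
      by [].
    - move=> t _; rewrite lee_fin hIm ler_norml.
      rewrite /cip; case: (f _) => a b; case: (g _) => c d /=.
      have := sqr_ge0 (a - d); have := sqr_ge0 (b - c).
      have := sqr_ge0 (a + d); have := sqr_ge0 (b + c).
      by rewrite !expr2; lra.
  have EI : (\int[mu]_t (2^-1 *
     (cip (f (s +i* t)) (f (s +i* t)) +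
      cip (g ((x1 + x2 - s) +i* t)) (g ((x1 + x2 - s) +i* t))))%:E)%E =
     (2^-1 * (\int[mu]_t cip (f (s +i* t)) (f (s +i* t)) +
      \int[mu]_t cip (g ((x1 + x2 - s) +i* t)) (g ((x1 + x2 - s) +i* t))))%:E.
    rewrite -RintegralD// -RintegralZl//.
      by rewrite /Rintegral fineK// integrable_fin_num.
    exact: (integrableD measurableT If Ig).
  rewrite EI lee_fin.
  have p0 : 0 < pi :> R by exact: pi_gt0.
  have m1 : line_mean f s <= N f ^+ 2 by apply: line_mean_le => //; lra.
  have m2 : line_mean g (x1 + x2 - s) <= N g ^+ 2 by apply: line_mean_le => //; lra.
  move: m1 m2; rewrite /line_mean /line_ip !ler_pdivrMl//.
  move: (Rintegral _ _ _) (Rintegral _ _ _) => A B m1 m2; lra.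
have x1in : x1 <= x1 <= x1' by rewrite lexx ltW.
have x1'in : x1 <= x1' <= x1' by rewrite lexx ltW.
have := strip_integral closed lt1 bound.
have hi s : x1 <= s <= x1' ->
    mu.-integrable setT (EFin \o (fun t => complex.Re (h (s +i* t)))).
  move=> sx; have := cip_integrable (Lf s sx) (Lg s sx).
  by apply: eq_integrable => // t _; rewrite /= hRe.
move=> /(_ (hi _ x1in) (hi _ x1'in)) /= H.
have e1 : x1 + x2 - x1 = x2 by ring.
have e2 : x1 + x2 - x1' = x2' by rewrite E; ring.
transitivity (\int[mu]_t complex.Re (h (x1 +i* t))).
  by apply: eq_Rintegral => t _; rewrite hRe e1.
by rewrite H; apply: eq_Rintegral => t _; rewrite hRe e2.
Qed.

(** By [line_ip_shift] the mean at the midpoint is the product of [f] on the line [x] with [f] on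
    the line [x'], to which [cip_AMGM] applies. *)
Lemma line_mean_midpoint f x x' : hardy2 R f -> 0 < x -> 0 < x' ->
  2 * line_mean f ((x + x') / 2) <= line_mean f x + line_mean f x'.
Proof.
move=> Hf x0 x0'.
have [L L'] := (hardy2_line Hf x0, hardy2_line Hf x0').
rewrite /line_mean (@line_ip_shift f f _ _ x x')//; try lra.
rewrite /line_ip mulrCA -mulrDr.
apply: ler_wpM2l; first by rewrite invr_ge0 pi_ge0.
have [I I'] := (cip_integrable L L, cip_integrable L' L').
rewrite -RintegralD// -RintegralZl//; last exact: cip_integrable.
apply: le_Rintegral => //.
- exact: (integrableZl measurableT 2 (cip_integrable L L')).
- exact: (integrableD measurableT I I').
- move=> y _; have := cip_AMGM (f (x +i* y)) (f (x' +i* y)).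
  by rewrite ler_norml; lra.
Qed.

(* A midpoint convex function that is bounded above on a half-line cannot
   increase: its increments along an arithmetic progression would not decrease. *)
Lemma line_mean_nonincreasing f x x' : hardy2 R f -> 0 < x -> x <= x' ->
  line_mean f x' <= line_mean f x.
Proof.
move=> Hf x0 xx'; rewrite leNgt; apply/negP => lt.
pose d := x' - x; have d0 : 0 <= d by rewrite /d; lra.
pose u n := line_mean f (x + n%:R * d).
have xn n : 0 < x + n%:R * d by have : 0 <= n%:R * d by [rewrite mulr_ge0]; lra.
have u01 : u 0%N = line_mean f x /\ u 1%N = line_mean f x'.
  by rewrite /u mul0r addr0 mul1r /d addrC subrK.
have step n : u 1%N - u 0%N <= u n.+1 - u n.
  elim: n => [|n IH]; first exact: lexx.
  have := line_mean_midpoint Hf (xn n) (xn n.+2).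
  have -> : (x + n%:R * d + (x + n.+2%:R * d)) / 2 = x + n.+1%:R * d.
    by rewrite -!(natr1 n.+1) -!(natr1 n); field.
  by move: IH; rewrite /u; lra.
have lin n : u 0%N + n%:R * (u 1%N - u 0%N) <= u n.
  elim: n => [|n IH]; first by rewrite mul0r addr0.
  by rewrite -natr1 mulrDl mul1r; have := step n; lra.
have e0 : 0 < u 1%N - u 0%N by case: u01 => -> ->; lra.
have u0 : 0 <= u 0%N by exact: line_mean_ge0.
have [n] : exists n, N f ^+ 2 / (u 1%N - u 0%N) < n%:R.
  by exists (Num.bound (N f ^+ 2 / (u 1%N - u 0%N))); apply: archi_boundP;
    rewrite divr_ge0 ?sqr_ge0// ltW.
rewrite ltr_pdivrMr// => H.
have := lin n; have : u n <= N f ^+ 2 by exact: line_mean_le.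
lra.
Qed.

(** The supremum of a nonincreasing function is its limit at the left end. The factor [a] serves to
    compare two functions along proportional abscissas. *)
Lemma line_mean_cvg f (a : R) : 0 < a -> hardy2 R f ->
  line_mean f (a * x) @[x --> 0^'+] --> N f ^+ 2.
Proof.
move=> a0 Hf; apply/cvgrPdist_le => e e0.
have [x0 x00 Hx0] : exists2 x0, 0 < x0 & N f ^+ 2 - e < line_mean f x0.
  apply: contrapT => H; suff : N f ^+ 2 <= N f ^+ 2 - e by lra.
  apply: hardy_norm_le => // x xgt; rewrite leNgt; apply/negP => ?.
  by apply: H; exists x.
have xa : 0 < x0 / a by rewrite divr_gt0.
near=> x.
have xgt : 0 < x by near: x; exact: nbhs_right_gt.
have xlt : x < x0 / a by near: x; exact: nbhs_right_lt.
have ax0 : 0 < a * x by rewrite mulr_gt0.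
have axx : a * x <= x0 by rewrite mulrC -ler_pdivlMr// ltW.
have := line_mean_le Hf ax0; have := line_mean_nonincreasing Hf ax0 axx.
by rewrite ler_norml; lra.
Unshelve. all: end_near. Qed.

Lemma hardy2D f g : hardy2 R f -> hardy2 R g -> hardy2 R (f + g).
Proof. by move=> Hf Hg; rewrite -[f]scale1r; exact: hardy2_lin. Qed.

Lemma hardy2_0 : hardy2 R (0 : C -> C^o).
Proof.
have E x y : cip ((0 : C -> C^o) (x +i* y)) ((0 : C -> C^o) (x +i* y)) = 0.
  by rewrite /cip /= !mul0r addr0.
apply: (@hardy2_intro _ _ 0) => //.
- move=> z _; exists 0 => e e0; exists 1 => // h _.
  rewrite (_ : _ - 0 * h = 0); last by rewrite mul0r subr0; exact: subrr.
  rewrite Normc.normc0 mulr_ge0//; first exact: ltW.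
  by rewrite -lecR; exact: (normr_ge0 h).
- move=> x x0; split; [by move=> y; exact: cvg_cst|by move=> y; exact: cvg_cst|].
  rewrite (_ : EFin \o _ = cst 0%E); first exact: integrable0.
  by apply/funext => y; rewrite /= E.
- move=> x x0; rewrite /line_mean /line_ip /Rintegral.
  under eq_integral do rewrite E.
  by rewrite integral0 mulr0.
Qed.

Lemma hardy2Z (c : C) f : hardy2 R f -> hardy2 R (c *: f).
Proof. by move=> Hf; rewrite -[c *: f]addr0; apply: hardy2_lin => //; exact: hardy2_0. Qed.

(** Squared norms are limits of means, so the identity [line_meanZ] passes to the limit. *)
Lemma hardy_normZ (c : C) f : hardy2 R f -> N (c *: f) ^+ 2 = cip c c * N f ^+ 2.
Proof.
move=> Hf; have := line_mean_cvg ltr01 (hardy2Z c Hf).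
have C2 : cip c c * line_mean f (1 * x) @[x --> 0^'+] --> cip c c * N f ^+ 2.
  by apply: cvgM; [exact: cvg_cst|exact: (line_mean_cvg ltr01 Hf)].
move=> C1.
have C3 : line_mean (c *: f) (1 * x) @[x --> 0^'+] --> cip c c * N f ^+ 2.
  apply: cvg_trans C2; apply: near_eq_cvg; near=> x.
  have xgt : 0 < x by near: x; exact: nbhs_right_gt.
  by rewrite line_meanZ// mul1r; exact: hardy2_line.
exact: (cvg_unique _ C1 C3).
Unshelve. all: end_near. Qed.

(** Twice the real part of the inner product of [f] and [g]. *)
Definition norm_polar f g : R := N (f + g) ^+ 2 - N f ^+ 2 - N g ^+ 2.

(** By [line_meanD] both sides are limits of twice a [line_ip] as [x] tends to 0 from the right, the
    first taken at [x] and the second at [a * x]. *)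
Lemma norm_polar_eq (a : R) f g f' g' : 0 < a ->
  hardy2 R f -> hardy2 R g -> hardy2 R f' -> hardy2 R g' ->
  (forall x, 0 < x -> line_ip f g x x = line_ip f' g' (a * x) (a * x)) ->
  norm_polar f g = norm_polar f' g'.
Proof.
move=> a0 Hf Hg Hf' Hg' E.
pose k (r : R) F G x := line_mean (F + G) (r * x) - line_mean F (r * x) - line_mean G (r * x).
have kc (r : R) F G : 0 < r -> hardy2 R F -> hardy2 R G ->
    k r F G x @[x --> 0^'+] --> norm_polar F G.
  move=> r0 HF HG; apply: cvgB; last exact: line_mean_cvg.
  by apply: cvgB; apply: line_mean_cvg => //; exact: hardy2D.
have C3 : k 1 f g x @[x --> 0^'+] --> norm_polar f' g'.
  apply: cvg_trans (kc a f' g' a0 Hf' Hg').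
  apply: near_eq_cvg; near=> x.
  have xgt : 0 < x by near: x; exact: nbhs_right_gt.
  have ax : 0 < a * x by rewrite mulr_gt0.
  rewrite /k mul1r !line_meanD; try exact: hardy2_line.
  by rewrite E//; ring.
exact: (cvg_unique _ (kc 1 f g ltr01 Hf Hg) C3).
Unshelve. all: end_near. Qed.

End HardyShift.

(** * Composition operators and their adjoints *)

Section AffineComposition.
Context {R : realType}.
Notation C := R[i].
Notation mu := (@lebesgue_measure R).
Notation N := (@hardy_norm R).
Implicit Types (f g : C -> C^o) (x y : R).

Definition affine_comp (a : R) (b : C) (f : C -> C^o) : C -> C^o :=
  composition_operator (fun w => a%:C * w + b) f.

Lemma affine_compE (a : R) (b : C) f x y : 0 < x ->
  affine_comp a b f (x +i* y) =
  f ((a * x + complex.Re b) +i* (a * y + complex.Im b)).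
Proof.
move=> x0; rewrite /affine_comp /composition_operator /= x0; congr f.
by apply/eqP; rewrite eq_complex /=; case: b => ? ? /=; rewrite !mul0r subr0 addr0 !eqxx.
Qed.

Section Bounded.
Variables (a : R) (b : C).
Hypotheses (a0 : 0 < a) (b0 : 0 <= complex.Re b).

Let shift_gt0 x : 0 < x -> 0 < a * x + complex.Re b.
Proof. by move=> x0; rewrite ltr_pwDl// mulr_gt0. Qed.

(** The affine map carries the line [Re z = x] onto [Re z = a * x + Re b] and stretches it by
    [a]. *)
Lemma line_mean_affine f x : hardy2 R f -> 0 < x ->
  line_mean (affine_comp a b f) x = a^-1 * line_mean f (a * x + complex.Re b).
Proof.
move=> Hf x0; have L := hardy2_line Hf (shift_gt0 x0).
by apply: (line_ip_affine (c := complex.Im b) a0 L L) => y; exact: affine_compE.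
Qed.

Lemma hardy2_affine f : hardy2 R f -> hardy2 R (affine_comp a b f).
Proof.
move=> Hf; apply: (@hardy2_intro _ _ (a^-1 * N f ^+ 2)).
- move=> z z0.
  have z0' : 0 < complex.Re (a%:C * z + b).
    have := shift_gt0 z0; case: (z) => ? ?; case: (b) => ? ? /=.
    by rewrite mul0r subr0.
  have [D df] := hardy2_cdiff Hf z0'.
  exists (D * a%:C); apply: cdiff_local (cdiff_affine df).
  (* The disc of this radius about [z] stays in the half-plane. *)
  exists (complex.Re z) => // h hz.
  rewrite /affine_comp /composition_operator ifT//.
  have := Re_le_normc h; rewrite ler_norml => /andP[h1 _].
  move: z0 hz h1; case: (z) => ? ?; case: h => ? ? /= *; lra.
- by move=> z /negP/negbTE z0; rewrite /affine_comp /composition_operator z0.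
- move=> x x0; have L := hardy2_line Hf (shift_gt0 x0).
  by apply: (L2_on_line_affine (c := complex.Im b) a0 L) => y; exact: affine_compE.
- move=> x x0; rewrite line_mean_affine//; apply: ler_wpM2l.
    by rewrite invr_ge0 ltW.
  by apply: line_mean_le => //; exact: shift_gt0.
Qed.

Lemma hardy_norm_affine f : hardy2 R f ->
  N (affine_comp a b f) ^+ 2 <= a^-1 * N f ^+ 2.
Proof.
move=> Hf; apply: hardy_norm_le; first exact: hardy2_affine.
move=> x x0; rewrite line_mean_affine//; apply: ler_wpM2l.
  by rewrite invr_ge0 ltW.
by apply: line_mean_le => //; exact: shift_gt0.
Qed.

Lemma affine_comp_lin (c : C) f g :
  affine_comp a b (c *: f + g) = c *: affine_comp a b f + affine_comp a b g.
Proof.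
apply/funext => w; rewrite /affine_comp /composition_operator !fctE.
by case: ifP => // _; rewrite scaler0 addr0.
Qed.

(* The adjoint of the composition operator: [k_w] being the reproducing kernel
   [z |-> 1 / (z + conj w)] up to a constant, it must send [k_w] to
   [k_(a w + b)], that is to [a^-1 k_w] composed with [z |-> (z + conj b) / a]. *)
Definition affine_comp_adjoint f : C -> C^o :=
  (a^-1)%:C *: affine_comp a^-1 ((a^-1)%:C * conjc b) f.

End Bounded.

Section Adjoint.
Variables (a : R) (b : C).
Hypotheses (a0 : 0 < a) (b0 : 0 <= complex.Re b).
Notation T := (affine_comp a b).
Notation S := (affine_comp_adjoint a b).

Let Re_b' : complex.Re ((a^-1)%:C * conjc b) = a^-1 * complex.Re b.
Proof. by case: (b) => ? ? /=; rewrite mul0r subr0. Qed.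

Let Im_b' : complex.Im ((a^-1)%:C * conjc b) = - (a^-1 * complex.Im b).
Proof. by case: (b) => ? ? /=; rewrite mul0r addr0 mulrN. Qed.

Let b'0 : 0 <= complex.Re ((a^-1)%:C * conjc b).
Proof. by rewrite Re_b' mulr_ge0// invr_ge0 ltW. Qed.

Let a'0 : 0 < a^-1. Proof. by rewrite invr_gt0. Qed.

Lemma hardy2_adjoint f : hardy2 R f -> hardy2 R (S f).
Proof. by move=> Hf; apply: hardy2Z; exact: hardy2_affine. Qed.

Lemma line_mean_adjoint f x : hardy2 R f -> 0 < x ->
  line_mean (S f) x = a^-1 * line_mean f (a^-1 * (x + complex.Re b)).
Proof.
move=> Hf x0; rewrite line_meanZ; last first.
  by apply: hardy2_line => //; exact: hardy2_affine.
(* The scalar contributes [a^-1 * a^-1] and the substitution contributes [a]. *)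
rewrite line_mean_affine// Re_b' -mulrDr invrK /cip /= mulr0 addr0.
by rewrite mulrA -[_ * a^-1 * a]mulrA mulVf ?gt_eqF// mulr1.
Qed.

(** Substitution puts [f] on the line [a * x + Re b] and the rescaled [g'] on the line [a * x].
    Shift invariance then exchanges the two abscissas, and [a^-1 * g'] on the line [a * x + Re b] is
    [S g] on the line [a * x]. *)
Lemma line_ip_adjoint f g x : hardy2 R f -> hardy2 R g -> 0 < x ->
  line_ip (T f) g x x = line_ip f (S g) (a * x) (a * x).
Proof.
move=> Hf Hg x0; have ax : 0 < a * x by rewrite mulr_gt0.
have axb : 0 < a * x + complex.Re b by rewrite ltr_pwDl.
pose g' := affine_comp a^-1 (0 +i* (- (a^-1 * complex.Im b))) g.
have Hg' : hardy2 R g' by exact: hardy2_affine.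
have [Lf Lg'] := (hardy2_line Hf axb, hardy2_line Hg' ax).
rewrite (@line_ip_affine _ f g' _ _ _ _ (a * x + complex.Re b) (a * x) a (complex.Im b))//.
- rewrite (@line_ip_shift _ f g' _ _ (a * x) (a * x + complex.Re b))//; last first.
    by rewrite addrC.
  rewrite /line_ip mulrCA; congr (_ * _).
  rewrite -RintegralZl//; last first.
    by apply: cip_integrable; apply: hardy2_line.
  apply: eq_Rintegral => y _; rewrite /affine_comp_adjoint /g' !fctE.
  rewrite !affine_compE// Re_b' Im_b' /= addr0 [a^-1 * (a * x + _)]mulrDr.
  by rewrite /cip; case: (f _) => ? ?; case: (g _) => ? ? /=; ring.
- by move=> y; exact: affine_compE.
- move=> y; rewrite /g' affine_compE// /= addr0 mulKf ?gt_eqF//.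
  by rewrite mulrDr mulKf ?gt_eqF// addrK.
Qed.

Lemma norm_polar_adjoint f g : hardy2 R f -> hardy2 R g ->
  norm_polar (T f) g = norm_polar f (S g).
Proof.
move=> Hf Hg.
exact: (norm_polar_eq a0 (hardy2_affine a0 b0 Hf) Hg Hf (hardy2_adjoint Hg)
  (fun x => @line_ip_adjoint f g x Hf Hg)).
Qed.

Lemma adjoint_lin (c : C) f g : S (c *: f + g) = c *: S f + S g.
Proof.
rewrite /affine_comp_adjoint affine_comp_lin scalerDr !scalerA.
by rewrite [_%:C * c]mulrC.
Qed.

Lemma hardy_norm_adjoint f : hardy2 R f -> N (S f) ^+ 2 <= a^-1 * N f ^+ 2.
Proof.
move=> Hf; apply: hardy_norm_le; first exact: hardy2_adjoint.
move=> x x0; rewrite line_mean_adjoint//; apply: ler_wpM2l.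
  by rewrite ltW.
by apply: line_mean_le => //; rewrite mulr_gt0// ltr_pwDl.
Qed.

Lemma bounded_of_sqr (U : (C -> C^o) -> C -> C^o) (B : R) : 0 <= B ->
  (forall f, hardy2 R f -> hardy2 R (U f)) ->
  (forall (c : C) f g, U (c *: f + g) = c *: U f + U g) ->
  (forall f, hardy2 R f -> N (U f) ^+ 2 <= B * N f ^+ 2) ->
  bounded_operator (hardy2 R) N U.
Proof.
move=> B0 HU lU NU; split=> [//|c f g _ _|]; first exact: lU.
exists (Num.sqrt B) => f Hf.
rewrite -(@ler_sqr R) ?nnegrE ?mulr_ge0 ?sqrtr_ge0 ?hardy_norm_ge0//.
by rewrite exprMn (sqr_sqrtr B0) NU.
Qed.

Lemma bounded_affine : bounded_operator (hardy2 R) N T.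
Proof.
apply: (@bounded_of_sqr _ a^-1); first by rewrite ltW.
- by move=> f; exact: hardy2_affine.
- exact: affine_comp_lin.
- by move=> f; exact: hardy_norm_affine.
Qed.

Lemma bounded_adjoint : bounded_operator (hardy2 R) N S.
Proof.
apply: (@bounded_of_sqr _ a^-1); first by rewrite ltW.
- by move=> f; exact: hardy2_adjoint.
- exact: adjoint_lin.
- by move=> f; exact: hardy_norm_adjoint.
Qed.

End Adjoint.

(** * The inner product recovered from norms *)

Lemma cipM (u v : C) : cip (u * v) (u * v) = cip u u * cip v v.
Proof. by rewrite /cip; case: u => ? ?; case: v => ? ? /=; ring. Qed.

Lemma cip_iX k : cip ('i ^+ k : C) ('i ^+ k) = 1.
Proof.
elim: k => [|k IH]; first by rewrite expr0 /cip /= mulr0 addr0 mulr1.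
by rewrite exprS cipM IH mulr1 /cip /= mulr0 add0r mulr1.
Qed.

(** Each ['i ^+ k *: g] has the norm of [g], so the squared norms of [f] and [g] enter with the
    factor [1 + i - 1 - i = 0]. *)
Lemma dot_polar f g (p : nat -> R) : hardy2 R f -> hardy2 R g ->
  (forall k, norm_polar f ('i ^+ k *: g) = p k) ->
  dot N f g = 4^-1 * \sum_(k < 4) ('i ^+ k * (p k)%:C).
Proof.
move=> Hf Hg fgp; rewrite /dot; congr (_ * _).
have E (k : nat) : N (f + 'i ^+ k *: g) ^+ 2 = p k + (N f ^+ 2 + N g ^+ 2).
  have NZ : N ('i ^+ k *: g) ^+ 2 = N g ^+ 2.
    by have := hardy_normZ ('i ^+ k) Hg; rewrite cip_iX mul1r.
  have := fgp k; revert NZ; unfold norm_polar.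
  generalize (N (f + 'i ^+ k *: g)) (N ('i ^+ k *: g)) (N f) (N g).
  by move=> r s p' q -> <-; ring.
under eq_bigr do rewrite E rmorphD/= mulrDr.
rewrite big_split/= -mulr_suml.
have -> : \sum_(k < 4) 'i ^+ k = 0 :> C.
  rewrite !big_ord_recr big_ord0 /= add0r.
  apply/eqP; rewrite eq_complex /=; apply/andP; split; apply/eqP; ring.
by rewrite mul0r addr0.
Qed.

(** [norm_polar_adjoint] concerns real parts only; applied to ['i ^+ k *: g], with the complex
    linearity of the adjoint, it gives the whole inner product. *)
Lemma is_adjoint_affine (a : R) (b : C) : 0 < a -> 0 <= complex.Re b ->
  is_adjoint (hardy2 R) N (affine_comp a b) (affine_comp_adjoint a b).
Proof.
move=> a0 b0; split; first exact: bounded_adjoint.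
move=> f g Hf Hg.
have S0 : affine_comp_adjoint a b 0 = 0.
  apply/funext => w; rewrite /affine_comp_adjoint /affine_comp.
  by rewrite /composition_operator !fctE; case: ifP; rewrite scaler0.
have E (k : nat) : norm_polar (affine_comp a b f) ('i ^+ k *: g) =
    norm_polar f ('i ^+ k *: affine_comp_adjoint a b g).
  rewrite (norm_polar_adjoint a0 b0 Hf (hardy2Z ('i ^+ k) Hg)).
  by rewrite -[_ *: g]addr0 adjoint_lin S0 addr0.
rewrite (dot_polar (hardy2_affine a0 b0 Hf) Hg E).
by rewrite (dot_polar Hf (hardy2_adjoint a0 b0 Hg) (fun k => erefl)).
Qed.

(** The terms [k = 1] and [k = 3] of the polarization sum are purely imaginary. *)
Lemma Re_dot f g :
  complex.Re (dot N f g) = (N (f + g) ^+ 2 - N (f - g) ^+ 2) / 4.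
Proof.
have Re_sum (q : nat -> R) :
    complex.Re (4^-1 * \sum_(k < 4) ('i ^+ k * (q k ^+ 2)%:C)) =
    (q 0%N ^+ 2 - q 2%N ^+ 2) / 4.
  by rewrite !big_ord_recr big_ord0 /=; field.
have q0 : N (f + 'i ^+ 0 *: g) = N (f + g) by rewrite expr0 scale1r.
have q2 : N (f + 'i ^+ 2 *: g) = N (f - g) by rewrite sqr_i scaleN1r.
rewrite -q0 -q2; exact: (Re_sum (fun k => N (f + 'i ^+ k *: g))).
Qed.

Lemma Re_dotC f g : hardy2 R f -> hardy2 R g ->
  complex.Re (dot N f g) = complex.Re (dot N g f).
Proof.
move=> Hf Hg.
have HN : hardy2 R (g - f).
  by have := hardy2_lin (-1) Hf Hg; rewrite scaleN1r addrC.
have E1 : N (f + g) ^+ 2 = N (g + f) ^+ 2 by rewrite addrC.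
have E2 : N (f - g) ^+ 2 = N (g - f) ^+ 2.
  have := hardy_normZ (-1) HN; rewrite scaleN1r opprB => ->.
  have -> : cip (-1 : C) (-1) = 1 by rewrite /cip /= oppr0 mulr0 addr0 mulrNN mulr1.
  exact: mul1r.
exact: (etrans (Re_dot f g)
  (etrans (f_equal2 (fun u v => (u - v) / 4) E1 E2) (esym (Re_dot g f)))).
Qed.

Lemma Re_dotff f : hardy2 R f -> complex.Re (dot N f f) = N f ^+ 2.
Proof.
move=> Hf.
have E1 : N (f + f) ^+ 2 = 4 * N f ^+ 2.
  rewrite -[f + f]/(f *+ 2) -scaler_nat (hardy_normZ 2%:R Hf).
  have -> : (2%:R : C) = (2 : R)%:C by rewrite rmorph_nat.
  by rewrite /cip /=; ring.
have E2 : N (f - f) ^+ 2 = 0.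
  have -> : f - f = 0 *: f by rewrite subrr scale0r.
  by rewrite (hardy_normZ 0 Hf) /cip /= !mul0r addr0 mul0r.
apply: (etrans (Re_dot f f)).
apply: (etrans (f_equal2 (fun u v => (u - v) / 4) E1 E2)).
by field.
Qed.

(* [N (S1 f) ^ 2 = Re <S1 f, S1 f> = Re <T S1 f, f> = Re <S1 f, S2 f>], and
   symmetrically for [S2]; the sesquilinearity of [dot] is not needed. *)
Lemma adjoint_norm_unique (T S1 S2 : (C -> C^o) -> C -> C^o) f :
  is_adjoint (hardy2 R) N T S1 -> is_adjoint (hardy2 R) N T S2 ->
  hardy2 R f -> N (S1 f) = N (S2 f).
Proof.
move=> [[H1 _ _] A1] [[H2 _ _] A2] Hf.
have [HS1 HS2] := (H1 f Hf, H2 f Hf).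
suff E : N (S1 f) ^+ 2 = N (S2 f) ^+ 2.
  by apply/eqP; rewrite -(@eqrXn2 _ 2) ?hardy_norm_ge0//; apply/eqP.
rewrite -Re_dotff// -A1// A2// Re_dotC// -A1// A2// Re_dotff//.
Qed.

End AffineComposition.

(** * The test function 1 / (z + 1) *)

Section TestFunction.
Context {R : realType}.
Notation C := R[i].
Notation mu := (@lebesgue_measure R).

(* Not cut off outside the half-plane, so that its lines [Re z = x] can be compared
   with the line [Re z = 0]. *)
Definition cauchy_kernel (z : C) : C^o := (z + 1)^-1.

Definition hardy_kernel (z : C) : C^o :=
  if 0 < complex.Re z then cauchy_kernel z else 0.

Let cauchy_kernelE (x y : R) : cauchy_kernel (x +i* y) =
  ((x + 1) / ((x + 1) ^+ 2 + y ^+ 2)) +i* (- (y / ((x + 1) ^+ 2 + y ^+ 2))).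
Proof. by apply/eqP; rewrite eq_complex /= addr0 !eqxx. Qed.

Let cip0 (y : R) : cip (cauchy_kernel (0 +i* y)) (cauchy_kernel (0 +i* y)) =
  (oneDsqr y)^-1.
Proof.
rewrite cauchy_kernelE /cip /oneDsqr /= add0r expr1n.
have : 1 + y ^+ 2 != 0 by rewrite gt_eqF// ltr_pwDl// sqr_ge0.
by move=> ?; field.
Qed.

Let integral_oneDsqr : (\int[mu]_y ((oneDsqr y)^-1)%:E = (pi / 2 + pi / 2)%:E)%E.
Proof.
have m : measurable_fun setT (fun y : R => ((oneDsqr y)^-1)%:E).
  by apply/measurable_EFinP; apply: continuous_measurable_fun; exact: continuous_oneDsqrV.
have p y : (0 <= ((oneDsqr y)^-1)%:E :> \bar R)%E.
  by rewrite lee_fin invr_ge0 (le_trans ler01 (oneDsqr_ge1 _)).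
have -> : [set: R] = `]-oo, 0%R] `|` `]0%R, +oo[.
  by rewrite -setCitvl setUC setvU.
rewrite ge0_integral_setU//=; last 2 first.
- exact: measurable_funTS.
- by rewrite -setCitvl; apply/disj_setPCl.
have -> : (\int[mu]_(y in `]0%R, +oo[) ((oneDsqr y)^-1)%:E = (pi / 2)%:E)%E.
  by rewrite integral_itv_obnd_cbnd ?integral0y_oneDsqr//; exact: measurable_funTS.
have -> : (\int[mu]_(y in `]-oo, 0%R]) ((oneDsqr y)^-1)%:E = (pi / 2)%:E)%E.
  rewrite -integral0y_oneDsqr (ge0_integration_by_substitution0 m p).
  by apply: eq_integral => y _; rewrite /oneDsqr sqrrN.
by rewrite EFinD.
Qed.

Let kernel_line0 : L2_on_line cauchy_kernel 0.
Proof.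
have den (y : R) : (0 + 1) ^+ 2 + y ^+ 2 != 0.
  by rewrite add0r expr1n gt_eqF// ltr_pwDl// sqr_ge0.
have cden : continuous (fun y : R => (0 + 1) ^+ 2 + y ^+ 2).
  by move=> y; apply: cvgD; [exact: cvg_cst|exact: exprn_continuous].
split.
- under eq_fun do rewrite cauchy_kernelE/=.
  move=> y; apply: cvgM; first exact: cvg_cst.
  by apply: cvgV => //; exact: cden.
- under eq_fun do rewrite cauchy_kernelE/=.
  move=> y; apply: cvgN; apply: cvgM; first exact: cvg_id.
  by apply: cvgV => //; exact: cden.
- apply/integrableP; split.
    apply/measurable_EFinP; under eq_fun do rewrite cip0.
    by apply: continuous_measurable_fun; exact: continuous_oneDsqrV.
  under eq_integral do rewrite /= cip0 ger0_norm ?invr_ge0 ?(le_trans ler01 (oneDsqr_ge1 _))//.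
  by rewrite integral_oneDsqr ltry.
Qed.

Let kernel_mean0 : line_mean cauchy_kernel 0 = 1.
Proof.
rewrite /line_mean /line_ip /Rintegral.
under eq_integral do rewrite cip0.
rewrite integral_oneDsqr /=.
by rewrite -splitr mulVf// gt_eqF// pi_gt0.
Qed.

(** Dividing numerator and denominator of [(x + 1) / (x + 1 + i y)] by [x + 1] reduces every line to
    the imaginary axis. *)
Let kernel_scale (x y : R) : 0 < x ->
  ((x + 1)%:C *: hardy_kernel) (x +i* y) = cauchy_kernel (0 +i* ((x + 1)^-1 * y + 0)).
Proof.
move=> x0; have x10 : 0 < x + 1 by lra.
rewrite fctE /hardy_kernel /= x0 addr0 !cauchy_kernelE add0r.
have d : (x + 1) ^+ 2 + y ^+ 2 != 0.
  by rewrite gt_eqF// ltr_pwDl ?sqr_ge0// exprn_gt0.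
have n0 : x + 1 != 0 by rewrite gt_eqF.
apply/eqP; rewrite eq_complex /=; apply/andP; split; apply/eqP.
  by field; rewrite n0 d.
by field; rewrite n0 d.
Qed.

Let kernelK x : 0 < x -> hardy_kernel = ((x + 1)^-1)%:C *: ((x + 1)%:C *: hardy_kernel).
Proof.
move=> x0; rewrite scalerA -rmorphM/= mulVf ?scale1r//.
by rewrite gt_eqF//; lra.
Qed.

Lemma hardy_kernel_line x : 0 < x -> L2_on_line hardy_kernel x.
Proof.
move=> x0; rewrite (kernelK x0); apply: L2_on_lineZ.
apply: (L2_on_line_affine (c := 0) _ kernel_line0 (fun y => kernel_scale y x0)).
by rewrite invr_gt0; lra.
Qed.

(** The scalar contributes [(x + 1)^-2], the substitution [x + 1], and the mean on the imaginary
    axis is 1. *)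
Lemma hardy_kernel_mean x : 0 < x -> line_mean hardy_kernel x = (x + 1)^-1.
Proof.
move=> x0; have n0 : x + 1 != 0 by rewrite gt_eqF//; lra.
rewrite (kernelK x0) line_meanZ; last by apply: L2_on_lineZ; exact: hardy_kernel_line.
have i0 : 0 < (x + 1)^-1 by rewrite invr_gt0; lra.
rewrite /line_mean (line_ip_affine (c := 0) i0 kernel_line0 kernel_line0
  (fun y => kernel_scale y x0) (fun y => kernel_scale y x0)).
rewrite -/(line_mean _ _) kernel_mean0 /cip /=.
by field.
Qed.

Lemma hardy2_kernel : hardy2 R hardy_kernel.
Proof.
apply: (@hardy2_intro _ _ 1).
- move=> z z0.
  have z1 : (z + 1 : C^o) != 0.
    apply/eqP => /(congr1 (@complex.Re R)); case: (z) z0 => ? ? /= ? ?; lra.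
  have [D dk] : exists D, cdiff cauchy_kernel z D.
    apply: derivable_cdiff; apply: derivableV; first exact: z1.
    apply: (@cdiff_derivable _ (fun w => w + 1) z 1) => e e0; exists 1 => // h _.
    have -> : z + h + 1 - (z + 1) - 1 * h = 0 by ring.
    rewrite Normc.normc0 mulr_ge0//; first exact: ltW.
    exact: le_trans (normr_ge0 _) (Re_le_normc h).
  exists D; apply: cdiff_local dk; exists (complex.Re z) => // h hz.
  rewrite /hardy_kernel ifT//.
  have := Re_le_normc h; rewrite ler_norml => /andP[h1 _].
  move: z0 hz h1; case: (z) => ? ?; case: h => ? ? /= *; lra.
- by move=> z /negP/negbTE z0; rewrite /hardy_kernel z0.
- by move=> x; exact: hardy_kernel_line.
- move=> x x0; rewrite hardy_kernel_mean// invf_le1; lra.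
Qed.

End TestFunction.

(** * Comparison of the norms of the composition operator and its adjoint *)

Theorem corollary3p2 (R : realType) (a : R) (b : R[i])
    (ha : 0 < a) (hb : 0 <= complex.Re b) :
  cohyponormal (hardy2 R) (@hardy_norm R)
    (composition_operator (fun w => a%:C * w + b))
  <-> (1 <= a \/ complex.Re b = 0).
Proof.
have Adj := is_adjoint_affine ha hb.
split=> [[_ [S AS TS]]|H].
- have [?|a1] := leP 1 a; [by left|right].
  apply: contrapT => /eqP b0.
  have {b0} bgt : 0 < complex.Re b by rewrite lt_neqAle eq_sym b0.
  set beta := complex.Re b in hb bgt.
  have b_lt : beta < a^-1 * beta by rewrite ltr_pMl// invf_gt1.
  pose K := @hardy_kernel R; have HK : hardy2 R K := hardy2_kernel.
  (* Chosen so that [a * x + beta] is the midpoint of [beta] and [a^-1 * beta], hence strictly below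
     [a^-1 * beta]. *)
  pose x := (a^-1 * beta - beta) / (2 * a).
  have x0 : 0 < x by rewrite divr_gt0 ?mulr_gt0// subr_gt0.
  have axE : a * x + beta = (a^-1 * beta + beta) / 2.
    by rewrite /x; field; rewrite gt_eqF.
  have := TS K HK; rewrite (adjoint_norm_unique AS Adj HK).
  rewrite -(@ler_sqr R) ?nnegrE ?hardy_norm_ge0// leNgt => /negP; apply.
  (* The separating value is [a^-1] times the mean of [K] at [a^-1 * beta]: it bounds every mean of
     the adjoint image, while the mean of the composition at [x] exceeds it. *)
  apply: (@le_lt_trans _ _ (a^-1 * (a^-1 * beta + 1)^-1)).
    apply: hardy_norm_le; first exact: hardy2_adjoint.
    move=> y y0; rewrite line_mean_adjoint// -/beta.
    have yb : a^-1 * beta <= a^-1 * (y + beta).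
      by rewrite ler_pM2l ?invr_gt0// lerDr ltW.
    rewrite hardy_kernel_mean; last by lra.
    by apply: ler_wpM2l; [rewrite invr_ge0 ltW|rewrite lef_pV2 ?posrE; lra].
  apply: lt_le_trans (line_mean_le (hardy2_affine ha hb HK) x0).
  rewrite line_mean_affine// -/beta hardy_kernel_mean axE; last by lra.
  by rewrite ltr_pM2l ?invr_gt0// ltf_pV2 ?posrE; lra.
- split; first exact: bounded_affine.
  exists (affine_comp_adjoint a b) => // f Hf.
  rewrite -(@ler_sqr R) ?nnegrE ?hardy_norm_ge0//.
  apply: hardy_norm_le; first exact: hardy2_affine.
  move=> x x0.
  (* This abscissa [x'] solves [(x' + Re b) / a = a * x + Re b], so the mean of the adjoint image at
     [x'] equals that of the composition at [x]. Its positivity is where [H] enters. *)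
  have x'0 : 0 < a ^+ 2 * x + (a - 1) * complex.Re b.
    apply: ltr_pwDl; first by rewrite mulr_gt0// exprn_gt0.
    by case: H => [a1|->]; rewrite ?mulr0// mulr_ge0// subr_ge0.
  apply: le_trans (line_mean_le (hardy2_adjoint ha hb Hf) x'0).
  rewrite line_mean_affine// line_mean_adjoint//.
  by have -> : a^-1 * (a ^+ 2 * x + (a - 1) * complex.Re b + complex.Re b) =
    a * x + complex.Re b by field; rewrite gt_eqF.
Qed.
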